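(* Let $k>1$ be an integer. Then for any ring $\widetilde{\mathbb{Z}}\equiv\mathbb{Z}$ one has $BS(1,k)\equiv BS(1,k,\widetilde{\mathbb{Z}})$ (as groups), and conversely every group elementarily equivalent to $BS(1,k)$ is isomorphic to $BS(1,k,\widetilde{\mathbb{Z}})$ for some ring $\widetilde{\mathbb{Z}}\equiv\mathbb{Z}$. Moreover, for any rings $\widetilde{\mathbb{Z}}_1\equiv\mathbb{Z}\equiv\widetilde{\mathbb{Z}}_2$ one has $BS(1,k,\widetilde{\mathbb{Z}}_1)\cong BS(1,k,\widetilde{\mathbb{Z}}_2)$ if and only if $\widetilde{\mathbb{Z}}_1\cong\widetilde{\mathbb{Z}}_2$.
   Context: $BS(1,k)=\langle a,b\mid b^{-1}ab=a^k\rangle$; elementary equivalence of groups is in the language $\{\cdot,{}^{-1},e\}$ and of rings in $\{+,\cdot,0,1\}$. For a ring $\widetilde{\mathbb{Z}}\equiv\mathbb{Z}$: the first-order formula defining in $\mathbb{Z}$ the exponentiation $x=y^z$ ($z\ge0$) defines in $\widetilde{\mathbb{Z}}$ an exponentiation, giving for each $i\in\widetilde{\mathbb{Z}}$ with $i\ge 0$ a unique element $k^i\in\widetilde{\mathbb{Z}}$ with $k^0=1$ and $k^{i_1}k^{i_2}=k^{i_1+i_2}$ (positivity in $\widetilde{\mathbb{Z}}$ is defined by the formula defining positive integers in $\mathbb{Z}$). Let $S=\{k^i: i>0\}\cup\{1\}$, let $\widetilde{\mathbb{Z}}[1/k^{\widetilde{\mathbb{Z}}}]=S^{-1}\widetilde{\mathbb{Z}}$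 be the ring of fractions and write $k^{-i}=1/k^i$. Then $BS(1,k,\widetilde{\mathbb{Z}})$ is the semidirect product $\widetilde{\mathbb{Z}}[1/k^{\widetilde{\mathbb{Z}}}]\rtimes\widetilde{\mathbb{Z}}$ of additive groups, with elements $(x,m)$ and product $(x_1,m_1)(x_2,m_2)=(x_1+x_2k^{-m_1},m_1+m_2)$. *)

(* Defs.v *)
From HB Require Import structures.
From mathcomp Require Import all_boot all_order all_algebra.
From mathcomp Require Import fraction.
From Stdlib Require Import ClassicalEpsilon.
Set Implicit Arguments. Unset Strict Implicit. Unset Printing Implicit Defensive.
Import Order.TTheory GRing.Theory Num.Theory.
Local Open Scope ring_scope.

Record signature := Signature { fsym : Type; arity : fsym -> nat }.

Record structure (L : signature) := Structure {
  sdom :> Type;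
  interp : forall f : fsym L, ('I_(arity f) -> sdom) -> sdom }.

Inductive term (L : signature) : Type :=
  | Var of nat
  | App (f : fsym L) of ('I_(arity f) -> term L).

Inductive formula (L : signature) : Type :=
  | FBot
  | FEq of term L & term L
  | FImp of formula L & formula L
  | FAll of nat & formula L.

Fixpoint eval (L : signature) (M : structure L) (rho : nat -> M) (t : term L) : M :=
  match t with
  | Var n => rho n
  | App f a => @interp L M f (fun i => eval rho (a i))
  end.

Definition upd (T : Type) (rho : nat -> T) (n : nat) (x : T) : nat -> T :=
  fun m => if m == n then x else rho m.

Fixpoint sat (L : signature) (M : structure L) (rho : nat -> M) (p : formula L) : Prop :=
  match p with
  | FBot => False
  | FEq t1 t2 => eval rho t1 = eval rho t2
  | FImp p q => sat rho p -> sat rho q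
  | FAll n p => forall x : M, sat (upd rho n x) p
  end.

Fixpoint term_fv_in (L : signature) (P : nat -> Prop) (t : term L) : Prop :=
  match t with
  | Var n => P n
  | App f a => forall i, term_fv_in P (a i)
  end.

Fixpoint fv_in (L : signature) (P : nat -> Prop) (p : formula L) : Prop :=
  match p with
  | FBot => True
  | FEq t1 t2 => term_fv_in P t1 /\ term_fv_in P t2
  | FImp p q => fv_in P p /\ fv_in P q
  | FAll n p => fv_in (fun m => m = n \/ P m) p
  end.

Definition sentence (L : signature) (p : formula L) : Prop := fv_in (fun _ => False) p.

Definition holds (L : signature) (M : structure L) (p : formula L) : Prop :=
  forall rho : nat -> M, sat rho p.

Definition elem_equiv (L : signature) (M N : structure L) : Prop :=
  forall p : formula L, sentence p -> (holds M p <-> holds N p).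

Inductive gsym := GMul | GInv | GOne.
Definition garity (f : gsym) : nat :=
  match f with GMul => 2 | GInv => 1 | GOne => 0 end.
Definition Lgroup := Signature garity.

Record group_str := GroupStr {
  gcar : Type;
  gmul : gcar -> gcar -> gcar;
  ginv : gcar -> gcar;
  gone : gcar }.

Definition group_struct (G : group_str) : structure Lgroup :=
  @Structure Lgroup (gcar G)
    (fun f => match f return ('I_(garity f) -> gcar G) -> gcar G with
              | GMul => fun a => @gmul G (a ord0) (a ord_max)
              | GInv => fun a => @ginv G (a ord0)
              | GOne => fun _ => gone G
              end).

Definition group_elem_equiv (G H : group_str) : Prop :=
  elem_equiv (group_struct G) (group_struct H).

Definition is_group (G : group_str) : Prop :=
  [/\ forall x y z : gcar G, @gmul G x (@gmul G y z) = @gmul G (@gmul G x y) z,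
      forall x : gcar G, @gmul G (@gone G) x = x
    & forall x : gcar G, @gmul G (@ginv G x) x = @gone G].

Definition group_iso (G H : group_str) : Prop :=
  exists f : gcar G -> gcar H,
    [/\ bijective f,
        forall x y, f (@gmul G x y) = @gmul H (f x) (f y),
        forall x, f (@ginv G x) = @ginv H (f x)
      & f (@gone G) = @gone H].

Definition group_hom (G H : group_str) (f : gcar G -> gcar H) : Prop :=
  forall x y, f (@gmul G x y) = @gmul H (f x) (f y).

Fixpoint gpow (G : group_str) (x : gcar G) (n : nat) : gcar G :=
  match n with 0 => @gone G | n'.+1 => @gmul G x (gpow x n') end.

Definition generated_by (G : group_str) (a b : gcar G) : Prop :=
  forall P : gcar G -> Prop,
    P a -> P b -> P (@gone G) ->
    (forall x y, P x -> P y -> P (@gmul G x y)) ->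
    (forall x, P x -> P (@ginv G x)) ->
    forall x, P x.

Definition is_BS_presentation (k : nat) (B : group_str) (a b : gcar B) : Prop :=
  [/\ is_group B,
      @gmul B (@gmul B (@ginv B b) a) b = gpow a k,
      generated_by a b
    & forall (H : group_str) (h1 h2 : gcar H), is_group H ->
        @gmul H (@gmul H (@ginv H h2) h1) h2 = gpow h1 k ->
        exists f : gcar B -> gcar H, [/\ group_hom f, f a = h1 & f b = h2]].

Inductive rsym := RAdd | RMul | RZero | ROne.
Definition rarity (f : rsym) : nat :=
  match f with RAdd => 2 | RMul => 2 | RZero => 0 | ROne => 0 end.
Definition Lring := Signature rarity.

Definition ring_struct (R : nzRingType) : structure Lring :=
  @Structure Lring R
    (fun f => match f return ('I_(rarity f) -> R) -> R with
              | RAdd => fun a => a ord0 + a ord_max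
              | RMul => fun a => a ord0 * a ord_max
              | RZero => fun _ => 0
              | ROne => fun _ => 1
              end).

Definition ring_elem_equiv (R S : nzRingType) : Prop :=
  elem_equiv (ring_struct R) (ring_struct S).

Definition ring_iso (R S : nzRingType) : Prop :=
  exists f : R -> S,
    [/\ bijective f,
        forall x y, f (x + y) = f x + f y,
        forall x y, f (x * y) = f x * f y
      & f 1 = 1].

(* Positivity and exponentiation in a ring elementarily equivalent to Z,
   via the first-order formulas defining them in Z.                    *)
Definition env3 (T : Type) (x y z : T) : nat -> T :=
  fun n => match n with 0 => x | 1 => y | _ => z end.

Definition defines_pos (p : formula Lring) : Prop :=
  fv_in (fun m => m = 0%N) p /\
  forall rho : nat -> int, sat (M := ring_struct int) rho p <-> 0 < rho 0%N.

Definition defines_exp (p : formula Lring) : Prop :=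
  fv_in (fun m => (m <= 2)%N) p /\
  forall rho : nat -> int, sat (M := ring_struct int) rho p <->
    (0 <= rho 2%N /\ rho 0%N = rho 1%N ^+ `|rho 2%N|%N).

Definition rpos (R : nzRingType) (i : R) : Prop :=
  forall p, defines_pos p -> sat (M := ring_struct R) (fun _ => i) p.

(* k^i in R (for i >= 0): the element defined by the exponentiation formula *)
Definition kpow (R : nzRingType) (k : nat) (i : R) : R :=
  epsilon (inhabits 0) (fun x : R =>
    forall p, defines_exp p -> sat (M := ring_struct R) (env3 x k%:R i) p).

Definition kpowS (R : nzRingType) (k : nat) (s : R) : Prop :=
  s = 1 \/ exists i, rpos i /\ s = kpow k i.

(* The ring of fractions S^-1 R, realised inside the fraction field of R
   (S consists of non-zero-divisors). *)
Definition in_loc (R : idomainType) (k : nat) (x : {fraction R}) : Prop :=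
  exists a s : R, kpowS k s /\ x = (FracField.tofrac a) / (FracField.tofrac s).

Definition loc (R : idomainType) (k : nat) := {x : {fraction R} | in_loc k x}.

Lemma in_loc0 (R : idomainType) (k : nat) : in_loc k (0 : {fraction R}).
Proof.
exists 0, 1; split; first by left.
by rewrite (rmorph0 (@FracField.tofrac R)) mul0r.
Qed.

(* projection of a fraction into S^-1 R (the identity on S^-1 R; only
   ever applied to elements of S^-1 R) *)
Definition to_loc (R : idomainType) (k : nat) (x : {fraction R}) : loc R k :=
  match excluded_middle_informative (in_loc k x) with
  | left h => exist _ x h
  | right _ => exist _ 0 (in_loc0 R k)
  end.

Definition kinvpow (R : idomainType) (k : nat) (m : R) : {fraction R} :=
  match excluded_middle_informative (m = 0 \/ rpos m) with
  | left _ => (FracField.tofrac (kpow k m))^-1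
  | right _ => FracField.tofrac (kpow k (- m))
  end.

(* BS(1,k,R) = S^-1 R  x|  R, with (x1,m1)(x2,m2) = (x1 + x2 k^(-m1), m1+m2) *)
Definition BSk (k : nat) (R : idomainType) : group_str :=
  @GroupStr (loc R k * R)%type
    (fun p q => (to_loc k (sval p.1 + sval q.1 * kinvpow k p.2), p.2 + q.2))
    (fun p => (to_loc k (- (sval p.1 * kinvpow k (- p.2))), - p.2))
    (exist _ 0 (in_loc0 R k), 0).

(* Main.v *)
Require Import Defs.
From HB Require Import structures.
From mathcomp Require Import all_boot all_order all_algebra.
From mathcomp Require Import fraction.
From Stdlib Require Import ClassicalEpsilon.
From mathcomp.classical Require Import boolp.
From mathcomp Require Import zify ring lra.
Set Implicit Arguments. Unset Strict Implicit. Unset Printing Implicit Defensive.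

(* In [Z[1/k] x| Z] let [u] be a nontrivial element of the normal part and [v] a
   solution of [v^-1 u v = u^k]. The centralizer of [v] is a copy of the additive
   group of the integers, and divisibility of exponents can be read off the action,
   because [m | n] iff [k^m - 1 | k^n - 1] in [Z[1/k]]; addition and divisibility
   define multiplication (Robinson). The congruence
   [k^(c n) - 1 = n (k^c - 1)] modulo [(k^c - 1)^2] defines [n |-> u^n], so the
   whole decomposition of the group over the ring of integers is first-order in
   [u] and [v]. A group elementarily equivalent to [BS(1,k)] therefore carries the
   same decomposition over a model [R] of the theory of [Z], and such a
   decomposition ([frame] below) determines the group up to isomorphism. Conversely
   its multiplication is given by a formula over [R], since exponentiation is
   definable in [Z], so groups with frames over elementarily equivalent rings are
   elementarily equivalent; and the definable ring recovers [R] from the group. *)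


(** * First-order definability *)

(** A nonstandard [R] offers no induction over its elements, so nearly every fact about [R] or [G]
    is obtained by transfer: it is put in first-order form and checked in the integers or in [Z[1/k]
    x| Z], where induction and rational arithmetic are available. For this reason definability is
    handled semantically, by predicates for which some formula is known to exist. The parameters [u]
    and [v] cannot be pinned down: an isomorphism or an elementary equivalence only provides some
    pair satisfying the same formulas, so the arguments run over all pairs with [BSrel] or [BSgen].
    The relation [v^-1 u v = u^k] governs standard powers of [v] only; for nonstandard exponents the
    ring exponentiation has to be read inside the group. *)

Section Syntax.
Variable L : signature.
Implicit Types (p q : formula L) (t : term L).

Lemma term_fv_mono t (P Q : nat -> Prop) :
  (forall m, P m -> Q m) -> term_fv_in P t -> term_fv_in Q t.
Proof. by move=> PQ; elim: t => [n|f a IH] /=; [exact: PQ|move=> h i; exact: IH]. Qed.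

Lemma fv_mono p (P Q : nat -> Prop) :
  (forall m, P m -> Q m) -> fv_in P p -> fv_in Q p.
Proof.
elim: p P Q => [|s t|p IHp q IHq|n p IH] P Q PQ //=.
- by case=> hs ht; split; apply: term_fv_mono PQ _.
- by case=> hp hq; split; [apply: IHp PQ hp|apply: IHq PQ hq].
- by apply: IH => m [->|/PQ]; [left|right].
Qed.

Lemma term_fv_bound t : exists b, term_fv_in (fun m => m < b) t.
Proof.
elim: t => [n|f a IH]; first by exists n.+1 => /=.
have [B hB] := fin_all_exists IH.
exists (\max_i B i) => /= i; apply: term_fv_mono (hB i) => m /leq_trans; apply.
exact: leq_bigmax.
Qed.

Lemma fv_bound p : exists b, fv_in (fun m => m < b) p.
Proof.
elim: p => [|s t|p [b hb] q [c hc]|n p [b hb]]; first by exists 0.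
- have [b hb] := term_fv_bound s; have [c hc] := term_fv_bound t.
  by exists (maxn b c); split; [apply: term_fv_mono hb|apply: term_fv_mono hc]
    => m; rewrite leq_max => ->; rewrite ?orbT.
- by exists (maxn b c); split; [apply: fv_mono hb|apply: fv_mono hc]
    => m; rewrite leq_max => ->; rewrite ?orbT.
- by exists b; apply: fv_mono hb => m; right.
Qed.

Lemma eval_ext (M : structure L) (P : nat -> Prop) (rho rho' : nat -> M) t :
  term_fv_in P t -> (forall m, P m -> rho m = rho' m) -> eval rho t = eval rho' t.
Proof.
move=> + e; elim: t => [n|f a IH] /= h; first exact: e.
by apply: congr1; apply: funext => i; exact: IH (h i).
Qed.

Lemma sat_ext (M : structure L) (P : nat -> Prop) (rho rho' : nat -> M) p :
  fv_in P p -> (forall m, P m -> rho m = rho' m) -> sat rho p <-> sat rho' p.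
Proof.
elim: p P rho rho' => [|s t|p IHp q IHq|n p IH] P rho rho' //=.
- by case=> hs ht e; rewrite (eval_ext hs e) (eval_ext ht e).
- by case=> hp hq e; rewrite (IHp _ _ _ hp e) (IHq _ _ _ hq e).
- move=> hp e; suff E x : sat (upd rho n x) p <-> sat (upd rho' n x) p.
    by split=> h x; apply/E.
  by apply: IH hp _ => m; rewrite /upd; case: eqP => // ne [/ne|/e].
Qed.

Lemma eval_subst t (s : nat -> term L) :
  exists t', forall (M : structure L) (rho : nat -> M),
    eval rho t' = eval (fun j => eval rho (s j)) t.
Proof.
elim: t => [n|f a IH]; first by exists (s n).
have [a' ha'] := fin_all_exists IH.
exists (App a') => M rho /=; apply: congr1; apply: funext => i; exact: ha'.
Qed.

(** Simultaneous substitution of terms for all variables. Only existence is claimed, because bound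
    variables have to be renamed to avoid capture. *)
Lemma sat_subst p (s : nat -> term L) :
  exists p', forall (M : structure L) (rho : nat -> M),
    sat rho p' <-> sat (fun j => eval rho (s j)) p.
Proof.
elim: p s => [|t1 t2|p IHp q IHq|n p IH] s.
- by exists (FBot _).
- have [t1' h1] := eval_subst t1 s; have [t2' h2] := eval_subst t2 s.
  by exists (FEq t1' t2') => M rho /=; rewrite h1 h2.
- have [p' hp] := IHp s; have [q' hq] := IHq s.
  by exists (FImp p' q') => M rho /=; rewrite hp hq.
- have [b hb] := fv_bound p; have [c hc] := choice (fun j => term_fv_bound (s j)).
  (* [m] is at least the strict bound [c j] on the variables of [s j], for each [j] that can be free
     in [p], so binding [m] captures nothing. *)
  pose m := \max_(j < b) c j.
  have [p' hp] := IH (fun j => if j == n then Var L m else s j).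
  exists (FAll m p') => M rho /=.
  suff E x : sat (upd rho m x) p' <-> sat (upd (fun j => eval rho (s j)) n x) p.
    by split=> h x; apply/E.
  rewrite hp; apply: sat_ext hb _ => j jb; rewrite /upd.
  case: (j == n); rewrite /= ?eqxx //; apply: eval_ext (hc j) _ => i ij.
  by rewrite ifF // ltn_eqF // (leq_trans ij) // (leq_bigmax (Ordinal jb)).
Qed.

Fixpoint closure (n : nat) p : formula L :=
  if n is n'.+1 then closure n' (FAll n' p) else p.

Lemma sentence_closure n p : fv_in (fun m => m < n) p -> sentence (closure n p).
Proof.
elim: n p => [|n IH] p /= h; first exact: fv_mono h.
by apply: IH => /=; apply: fv_mono h => m; rewrite ltnS leq_eqVlt => /predU1P.
Qed.

Lemma holds_closure (M : structure L) n p : holds M (closure n p) <-> holds M p.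
Proof.
elim: n p => [|n IH] p //=; rewrite IH; split=> h rho.
  have := h rho (rho n); suff -> : upd rho n (rho n) = rho by [].
  by apply: funext => m; rewrite /upd; case: eqP => // ->.
by move=> x; exact: h.
Qed.

Lemma sat_iso (M N : structure L) (h : M -> N) :
  (forall y, exists x, y = h x) -> injective h ->
  (forall f a, h (interp (f := f) a) = interp (f := f) (fun i => h (a i))) ->
  forall p rho, sat rho p <-> sat (fun n => h (rho n)) p.
Proof.
move=> hs hi hf.
have he t rho : h (eval rho t) = eval (fun n => h (rho n)) t.
  elim: t => [n|f a IH] //=; rewrite hf; apply: congr1; exact: funext.
elim=> [|s t|p IHp q IHq|n p IH] rho //=.
- by rewrite -!he; split=> [->|/hi].
- by rewrite IHp IHq.
- have E x : upd (fun m => h (rho m)) n (h x) = (fun m => h (upd rho n x m)).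
    by apply: funext => m; rewrite /upd; case: eqP.
  split=> [H y|H x]; last by apply/IH; rewrite -E; exact: H.
  by have [x ->] := hs y; rewrite E; apply/IH.
Qed.

End Syntax.

(* [S : I -> structure L] is a class of structures; [def P] says that one
   formula defines [P i] in every [S i] at once. *)
Section Definability.
Variables (L : signature) (I : Type) (S : I -> structure L).

Definition tdef (s : forall i, (nat -> S i) -> S i) :=
  exists t : term L, forall i rho, eval rho t = s i rho.

Definition def (P : forall i, (nat -> S i) -> Prop) :=
  exists p : formula L, forall i rho, sat rho p <-> P i rho.

Implicit Types P Q : forall i, (nat -> S i) -> Prop.

Lemma tdef_var n : tdef (fun i rho => rho n).
Proof. by exists (Var _ n). Qed.

Lemma def_iff P Q : (forall i rho, P i rho <-> Q i rho) -> def P -> def Q.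
Proof. by move=> PQ [p hp]; exists p => i rho; rewrite hp. Qed.

Lemma def_False : def (fun _ _ => False).
Proof. by exists (FBot _). Qed.

Lemma def_eq s t : tdef s -> tdef t -> def (fun i rho => s i rho = t i rho).
Proof. by move=> [s' hs] [t' ht]; exists (FEq s' t') => i rho /=; rewrite hs ht. Qed.

Lemma def_imp P Q : def P -> def Q -> def (fun i rho => P i rho -> Q i rho).
Proof. by move=> [p hp] [q hq]; exists (FImp p q) => i rho /=; rewrite hp hq. Qed.

Lemma def_not P : def P -> def (fun i rho => ~ P i rho).
Proof. by move=> /def_imp/(_ def_False). Qed.

Lemma def_and P Q : def P -> def Q -> def (fun i rho => P i rho /\ Q i rho).
Proof.
move=> dP dQ; apply: def_iff (def_not (def_imp dP (def_not dQ))) => i rho.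
split=> [h|[hp hq]]; last by apply.
by apply: contrapT => nh; apply: h => hp hq; apply: nh.
Qed.

Lemma def_or P Q : def P -> def Q -> def (fun i rho => P i rho \/ Q i rho).
Proof.
move=> dP dQ; apply: def_iff (def_imp (def_not dP) dQ) => i rho.
split=> [h|[] //]; by have [|/h] := pselect (P i rho); [left|right].
Qed.

Lemma def_equiv P Q : def P -> def Q -> def (fun i rho => P i rho <-> Q i rho).
Proof. by move=> dP dQ; apply: def_and; apply: def_imp. Qed.

Lemma def_subst P (s : nat -> forall i, (nat -> S i) -> S i) :
  (forall n, tdef (s n)) -> def P -> def (fun i rho => P i (fun n => s n i rho)).
Proof.
move=> /choice[s' hs] [p hp]; have [p' hp'] := sat_subst p s'.
exists p' => i rho; rewrite hp' hp.
by have -> : (fun n => s n i rho) = (fun n => eval rho (s' n)) by apply: funext => n; rewrite hs.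
Qed.

Lemma def_rename P (s : nat -> nat) :
  def P -> def (fun i rho => P i (fun j => rho (s j))).
Proof. by apply: def_subst => n; exact: tdef_var. Qed.

Lemma def_allN P n : def P -> def (fun i rho => forall x, P i (upd rho n x)).
Proof. by move=> [p hp]; exists (FAll n p) => i rho; split=> h x; apply/hp/h. Qed.

(** Quantification in de Bruijn style: the bound element becomes variable 0 and the context is
    shifted. Definability goals then decompose by the shape of the predicate, without any choice of
    names. *)
Lemma def_all (Q : forall i, S i -> (nat -> S i) -> Prop) :
  def (fun i rho => Q i (rho 0) (fun n => rho n.+1)) ->
  def (fun i rho => forall x, Q i x rho).
Proof.
move=> [q hq]; have [b hb] := fv_bound q.
have [q' hq'] := sat_subst q (fun j => Var L (if j is j'.+1 then j' else b)).
exists (FAll b q') => i rho /=.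
suff E x : sat (upd rho b x) q' <-> Q i x rho by split=> h x; apply/E/h.
rewrite hq' -(hq i (fun j => if j is j'.+1 then rho j' else x)).
apply: sat_ext hb _ => -[|j] jb; rewrite /upd /= ?eqxx //.
by rewrite ltn_eqF // ltnW.
Qed.

Lemma def_ex (Q : forall i, S i -> (nat -> S i) -> Prop) :
  def (fun i rho => Q i (rho 0) (fun n => rho n.+1)) ->
  def (fun i rho => exists x, Q i x rho).
Proof.
move=> /def_not/(@def_all (fun i x rho => ~ Q i x rho))/def_not; apply: def_iff => i rho.
split=> [h|[x hx]]; last by move/(_ x).
by apply: contrapT => h'; apply: h => x hx; apply: h'; exists x.
Qed.

(** [defines_pos] and [defines_exp] restrict the free variables, which [def] leaves open. The
    surplus variables are quantified universally; this keeps the meaning, since [P] does not depend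
    on them. *)
Lemma def_bounded P n : def P ->
  (forall i rho rho', (forall m, m < n -> rho m = rho' m) -> P i rho <-> P i rho') ->
  exists p : formula L, fv_in (fun m => m < n) p /\ forall i rho, sat rho p <-> P i rho.
Proof.
move=> [p hp] Pn; have [b hb] := fv_bound p.
have {hb} : fv_in (fun m => m < n + b) p.
  by apply: fv_mono hb => m /leq_trans; apply; exact: leq_addl.
elim: b p hp => [|b IH] p hp h; first by exists p; rewrite addn0 in h.
apply: (IH (FAll (n + b) p)) => [i rho|] /=.
  have E x : sat (upd rho (n + b) x) p <-> P i rho.
    rewrite hp; apply: Pn => m mn; rewrite /upd ifF //.
    by rewrite ltn_eqF // (leq_trans mn) ?leq_addr.
  by split=> [/(_ (rho 0))|/E //]; move/E.
by apply: fv_mono h => m; rewrite addnS ltnS leq_eqVlt => /predU1P.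
Qed.

(** The transfer principle: truth at all assignments is truth of the universal closure, which is a
    sentence. *)
Lemma def_transfer P i j : def P -> elem_equiv (S i) (S j) ->
  (forall rho, P i rho) -> forall rho, P j rho.
Proof.
move=> [p hp] e h rho; have [b hb] := fv_bound p.
apply/hp; move: rho; apply/(holds_closure _ b)/(e _ (sentence_closure hb)).
by apply/holds_closure => rho; apply/hp.
Qed.

(** Reduces a macro applied to terms to the macro applied to variables, so that its quantifiers
    shift variables and never the opaque [r], [s], [t]. *)
Lemma def_subst3 (P : forall i, S i -> S i -> S i -> Prop) r s t :
  tdef r -> tdef s -> tdef t ->
  def (fun i rho => P i (rho 0) (rho 1) (rho 2)) ->
  def (fun i rho => P i (r i rho) (s i rho) (t i rho)).
Proof.
by move=> hr hs ht /(def_subst (s := fun n => nth t [:: r; s] n)); apply=> -[|[|[|n]]].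
Qed.

Lemma def_subst5 (P : forall i, S i -> S i -> S i -> S i -> S i -> Prop) r s t u v :
  tdef r -> tdef s -> tdef t -> tdef u -> tdef v ->
  def (fun i rho => P i (rho 0) (rho 1) (rho 2) (rho 3) (rho 4)) ->
  def (fun i rho => P i (r i rho) (s i rho) (t i rho) (u i rho) (v i rho)).
Proof.
move=> hr hs ht hu hv /(def_subst (s := fun n => nth v [:: r; s; t; u] n)).
by apply=> -[|[|[|[|[|n]]]]].
Qed.

End Definability.
Import Order.TTheory GRing.Theory Num.Theory.
Local Open Scope ring_scope.

(** * Four squares *)

(** Pigeonhole in ['F_p]: for [p = 2 h + 1], the [h + 1] squares [i ^ 2] and the [h + 1] values
    [- 1 - j ^ 2] with [i, j <= h] cannot form disjoint sets. *)
Lemma prime_dvd_sum_squares (p : nat) : prime p ->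
  exists a b m, [/\ (0 < m)%N, (m < p)%N & (m * p = 1 + a ^ 2 + b ^ 2)%N].
Proof.
move=> p_pr; have [->|p2] := eqVneq p 2; first by exists 1%N, 0%N, 1%N.
have p_odd : odd p by case: (even_prime p_pr) => // e; rewrite e in p2.
have pE := odd_double_half p; rewrite p_odd in pE; set h := p./2 in pE.
have F0 (n : nat) : (n%:R == 0 :> 'F_p) = (p %| n)%N.
  by rewrite (dvdn_pcharf (pchar_Fp p_pr)).
pose f (i : 'I_h.+1) : 'F_p := (i%:R) ^+ 2; pose g (i : 'I_h.+1) : 'F_p := -1 - (i%:R) ^+ 2.
have f_inj : injective f.
  move=> i j /eqP; rewrite /f -subr_eq0 subr_sqr mulf_eq0 => /orP[|].
    have le (a b : 'I_h.+1) : (b <= a)%N -> (a%:R - b%:R == 0 :> 'F_p) -> a = b.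
      move=> ba; rewrite -natrB // F0 => /dvdnP[q qE]; apply: val_inj => /=.
      by have := ltn_ord a; case: q qE => [|q]; nia.
    case: (leqP j i) => [/le//|/ltnW ij]; rewrite -oppr_eq0 opprB => e.
    by rewrite (le _ _ ij e).
  rewrite -natrD F0 => /dvdnP[q qE]; apply: val_inj => /=.
  by have := ltn_ord i; have := ltn_ord j; case: q qE => [|q]; nia.
have g_inj : injective g by move=> i j /addrI/oppr_inj; exact: f_inj.
have : ~~ [disjoint [set f i | i : 'I_h.+1] & [set g i | i : 'I_h.+1]].
  rewrite -setI_eq0 -card_gt0.
  have := cardsUI [set f i | i : 'I_h.+1] [set g i | i : 'I_h.+1].
  rewrite !card_imset // card_ord => e.
  have : (#|[set f i | i : 'I_h.+1] :|: [set g i | i : 'I_h.+1]| <= p)%N.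
    by rewrite -[X in (_ <= X)%N](card_Fp p_pr) max_card.
  by move: e; lia.
case/pred0Pn => _ /= /andP[/imsetP[i _ ->] /imsetP[j _ e]].
have : (1 + i ^ 2 + j ^ 2)%:R == 0 :> 'F_p.
  rewrite !natrD !natrX; move: e; rewrite /f /g => ->; apply/eqP; ring.
rewrite F0 => /dvdnP[m /esym mE]; exists i, j, m; split=> //.
- by case: m mE.
(* Since [i, j <= h], one has [m p <= 1 + 2 h ^ 2 < p ^ 2]; the resulting [m < p] drives the
   induction in [four_squares]. *)
- suff : (m * p < p * p)%N by rewrite ltn_pmul2r ?prime_gt0.
  have le (l : 'I_h.+1) : (l * l <= h * h)%N by have := ltn_ord l; nia.
  have := le i; have := le j; have := prime_gt1 p_pr.
  by rewrite mE -pE -!mulnn -muln2; nia.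
Qed.

(* The weak form of Lagrange's theorem suffices and needs no descent: if
   [m p = 1 + a^2 + b^2] with [m < p] and [m y^2] is a sum of four squares,
   then so is [p (m y)^2], by Euler's identity. *)
Lemma four_squares (n : nat) : (0 < n)%N -> exists y a b c d : int,
  y != 0 /\ n%:R * (y * y) = a * a + b * b + (c * c + d * d).
Proof.
have euler (u v a b c d a' b' c' d' : int) :
    u = a * a + b * b + (c * c + d * d) ->
    v = a' * a' + b' * b' + (c' * c' + d' * d') ->
    exists a'' b'' c'' d'', u * v = a'' * a'' + b'' * b'' + (c'' * c'' + d'' * d'').
  move=> -> ->; exists (a * a' + b * b' + c * c' + d * d'),
    (a * b' - b * a' + c * d' - d * c'), (a * c' - b * d' - c * a' + d * b'),
    (a * d' + b * c' - c * b' - d * a'); ring.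
elim/ltn_ind: n => n IH n0.
have [->|n1] := eqVneq n 1%N; first by exists 1, 1, 0, 0, 0.
have [n_pr|] := boolP (prime n).
  have [a [b [m [m0 mp e]]]] := prime_dvd_sum_squares n_pr.
  have [y [a' [b' [c' [d' [y0 e']]]]]] := IH m mp m0.
  have E : (m * n)%:R = (1 : int) * 1 + a%:R * a%:R + (b%:R * b%:R + 0 * 0).
    by rewrite e !natrD !natrX; ring.
  have [A [B [C [D E']]]] := euler _ _ _ _ _ _ _ _ _ _ E e'.
  exists (m%:R * y), A, B, C, D; split; last by rewrite -E' natrM; ring.
  by rewrite mulf_neq0 //; lia.
case/primePn => [n2|[q q1 /dvdnP[r rE]]]; first lia.
have [y [a [b [c [d [y0 e]]]]]] := IH q ltac:(lia) ltac:(lia).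
have [y' [a' [b' [c' [d' [y0' e']]]]]] := IH r ltac:(nia) ltac:(nia).
have [A [B [C [D E']]]] := euler _ _ _ _ _ _ _ _ _ _ e e'.
exists (y * y'), A, B, C, D; split; first by rewrite mulf_neq0.
by rewrite -E' rE natrM; ring.
Qed.

(** * Order and exponentiation in the language of rings *)

Section Operations.
Variables (L : signature) (I : Type) (S : I -> structure L).

Definition op1 (M : structure L) (f : Defs.fsym L) (x : M) : M := interp (f := f) (fun=> x).
Definition op2 (M : structure L) (f : Defs.fsym L) (x y : M) : M :=
  interp (f := f) (fun i => if i == 0%N :> nat then x else y).

Lemma tdef_op2 f (s t : forall i, (nat -> S i) -> S i) :
  tdef s -> tdef t -> tdef (fun i rho => op2 f (s i rho) (t i rho)).
Proof.
move=> [s' hs] [t' ht].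
exists (App (fun i : 'I_(arity f) => if i == 0%N :> nat then s' else t')) => i rho /=.
by apply: congr1; apply: funext => j; case: ifP.
Qed.

End Operations.

Section RingLanguage.
Variable M : structure Lring.
Implicit Types x y z : M.

Definition radd x y : M := op2 (RAdd : Defs.fsym Lring) x y.
Definition rmul x y : M := op2 (RMul : Defs.fsym Lring) x y.
Definition rzero : M := @interp Lring M RZero (fun i => match notF (ltn_ord i) with end).
Definition rone : M := @interp Lring M ROne (fun i => match notF (ltn_ord i) with end).
Fixpoint rnat (n : nat) : M := if n is n'.+1 then radd rone (rnat n') else rzero.

(** The factor [y y] leaves the sign of [x] unchanged, so the weak four-square theorem is enough to
    see that this is positivity. *)
Definition Pos x := x <> rzero /\ exists y a b c d, y <> rzero /\
  rmul x (rmul y y) = radd (radd (rmul a a) (rmul b b)) (radd (rmul c c) (rmul d d)).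

Definition NN x := x = rzero \/ Pos x.

Definition Rem c m r := NN r /\ (exists e, Pos e /\ radd r e = m) /\
  exists q, c = radd (rmul q m) r.

(** Goedel's modulus [1 + (i + 1) d]. *)
Definition modulus d i := radd rone (radd d (rmul i d)).

(** [c] and [d] code the sequence [1, y, y^2, ..., y^z] by remainders; as these are nonnegative, the
    definition is meant for [y >= 0]. *)
Definition ExpN x y z := exists c d, NN d /\ Rem c (modulus d rzero) rone /\
  (forall i e r, NN i -> Pos e -> radd i e = z -> Rem c (modulus d i) r ->
     Rem c (modulus d (radd i rone)) (rmul r y)) /\
  Rem c (modulus d z) x.

(* Goedel's beta function codes sequences of natural numbers, hence the detour
   through the even powers of [y]. *)
Definition Exp x y z := NN z /\ exists t, NN t /\
  ((radd t t = z /\ ExpN x (rmul y y) t) \/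
   (radd (radd t t) rone = z /\ exists w, ExpN w (rmul y y) t /\ x = rmul w y)).

End RingLanguage.

Arguments radd : simpl never.
Arguments rmul : simpl never.
Arguments rzero : simpl never.
Arguments rone : simpl never.

Section RingDefinability.
Variables (I : Type) (S : I -> structure Lring).
Implicit Types s t r : forall i, (nat -> S i) -> S i.

Lemma tdef_radd s t : tdef s -> tdef t -> tdef (fun i rho => radd (s i rho) (t i rho)).
Proof. exact: tdef_op2. Qed.
Lemma tdef_rmul s t : tdef s -> tdef t -> tdef (fun i rho => rmul (s i rho) (t i rho)).
Proof. exact: tdef_op2. Qed.
Lemma tdef_rzero : tdef (fun i (rho : nat -> S i) => rzero (S i)).
Proof.
exists (@App Lring RZero (fun i => match notF (ltn_ord i) with end)) => i rho /=.
by apply: congr1; apply: funext => -[].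
Qed.
Lemma tdef_rone : tdef (fun i (rho : nat -> S i) => rone (S i)).
Proof.
exists (@App Lring ROne (fun i => match notF (ltn_ord i) with end)) => i rho /=.
by apply: congr1; apply: funext => -[].
Qed.
Lemma tdef_rnat n : tdef (fun i (rho : nat -> S i) => rnat (S i) n).
Proof. by elim: n => [|n IH] /=; [exact: tdef_rzero|exact: tdef_radd tdef_rone IH]. Qed.
End RingDefinability.

Ltac fo_step := first
  [ exact: tdef_var | exact: tdef_rzero | exact: tdef_rone | exact: tdef_rnat
  | apply: tdef_radd | apply: tdef_rmul | apply: def_eq
  | apply: def_and | apply: def_or | apply: def_not | apply: def_equiv
  | apply: def_ex | apply: def_all | exact: def_False | apply: def_imp ].
Ltac fo := repeat fo_step.

Section RingDefinability2.
Variables (I : Type) (S : I -> structure Lring).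
Implicit Types s t r : forall i, (nat -> S i) -> S i.

Lemma def_Pos s : tdef s -> def (fun i rho => Pos (s i rho)).
Proof. by move=> ds; apply: (def_subst3 (P := fun i x _ _ => Pos x) ds ds ds); fo. Qed.

Lemma def_NN s : tdef s -> def (fun i rho => NN (s i rho)).
Proof. by move=> ds; apply: def_or; [fo|exact: def_Pos]. Qed.

Lemma def_Rem r s t : tdef r -> tdef s -> tdef t ->
  def (fun i rho => Rem (r i rho) (s i rho) (t i rho)).
Proof.
move=> dr ds dt; apply: (def_subst3 (P := fun i => @Rem (S i)) dr ds dt); rewrite /Rem.
by repeat first [apply: def_NN | apply: def_Pos | fo_step].
Qed.

Lemma def_ExpN r s t : tdef r -> tdef s -> tdef t ->
  def (fun i rho => ExpN (r i rho) (s i rho) (t i rho)).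
Proof.
move=> dr ds dt; apply: (def_subst3 (P := fun i => @ExpN (S i)) dr ds dt); rewrite /ExpN.
by rewrite /modulus; repeat first [apply: def_NN | apply: def_Pos | apply: def_Rem | fo_step].
Qed.

Lemma def_Exp r s t : tdef r -> tdef s -> tdef t ->
  def (fun i rho => Exp (r i rho) (s i rho) (t i rho)).
Proof.
move=> dr ds dt; apply: (def_subst3 (P := fun i => @Exp (S i)) dr ds dt); rewrite /Exp.
by repeat first [apply: def_NN | apply: def_ExpN | fo_step].
Qed.
End RingDefinability2.

Lemma beta_code (s : nat -> nat) (n : nat) : exists c d : nat, forall i, (i <= n)%N ->
  (s i < 1 + (d + i * d) /\ c %% (1 + (d + i * d)) = s i)%N.
Proof.
(* [N!] is at least every value [s i] and divisible by every positive difference of indices up to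
   [n]. *)
pose N := (n + \max_(i < n.+1) s i)%N; pose d := N`!; pose m i := (1 + (d + i * d))%N.
have sm i : (i <= n)%N -> (s i < m i)%N.
  rewrite -ltnS => i_n; rewrite /m ltnS (leq_trans _ (leq_addr _ _)) //.
  apply: leq_trans (fact_geq _); apply: leq_trans (leq_addl _ _).
  exact: (leq_bigmax (Ordinal i_n)).
have md i : coprime (m i) d by rewrite /m -mulSn addnC coprime_sym /coprime gcdnMDl gcdn1.
have mm i j : (i < j)%N -> (j <= n)%N -> coprime (m i) (m j).
  move=> ij jn; set g := gcdn (m i) (m j).
  have gd : coprime g d by exact: coprime_dvdl (dvdn_gcdl _ _) (md i).
  (* A common divisor [g] of two moduli is prime to [d], so it divides [j - i] and hence [N! = d];
     being also prime to [d], it is 1. *)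
  have gij : (g %| (j - i) * d)%N.
    have -> : ((j - i) * d = m j - m i)%N by rewrite /m mulnBl; nia.
    by rewrite dvdn_sub ?dvdn_gcdl ?dvdn_gcdr.
  rewrite Gauss_dvdl // in gij.
  have {}gij : (g %| d)%N.
    by apply: dvdn_trans gij _; apply: dvdn_fact; rewrite subn_gt0 ij /N; lia.
  by rewrite /coprime -/g -(gcdn_idPl gij).
suff [c hc] : exists c, forall i, (i < n.+1)%N -> c = s i %[mod m i].
  by exists c, d => i i_n; rewrite sm //= -/(m i) hc // modn_small // sm.
have: (n.+1 <= n.+1)%N by []; move: {1 3}n.+1 => k; elim: k => [|k IH] kn; first by exists 0%N.
have [c hc] := IH (ltnW kn).
have cop : coprime (\prod_(i < k) m i) (m k).
  elim/big_rec: _ => [|i x _ hx]; first exact: coprime1n.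
  by rewrite coprimeMl hx mm.
exists (chinese (\prod_(i < k) m i) (m k) c (s k)) => i.
rewrite ltnS leq_eqVlt => /predU1P[->|ik]; first exact: chinese_modr.
have mi : (m i %| \prod_(i < k) m i)%N.
  by rewrite (bigD1 (Ordinal ik)) //= dvdn_mulr.
by rewrite -(modn_dvdm _ mi) chinese_modl // modn_dvdm // hc.
Qed.

Section RingStruct.
Variable R : nzRingType.
Implicit Types x y : R.
Lemma raddE x y : radd (M := ring_struct R) x y = x + y. Proof. by []. Qed.
Lemma rmulE x y : rmul (M := ring_struct R) x y = x * y. Proof. by []. Qed.
Lemma rzeroE : rzero (ring_struct R) = 0. Proof. by []. Qed.
Lemma roneE : rone (ring_struct R) = 1. Proof. by []. Qed.
Lemma rnatE n : rnat (ring_struct R) n = n%:R.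
Proof. by elim: n => [|n IH] //=; rewrite raddE IH roneE mulrS. Qed.
End RingStruct.
Definition ringE := (raddE, rmulE, rzeroE, roneE, rnatE).

Lemma Pos_int (x : int) : Pos (M := ring_struct int) x <-> 0 < x.
Proof.
split=> [[/eqP x0 [y [a [b [c [d [/eqP y0 e]]]]]]]|x0].
  move: x0 y0 e; rewrite !ringE => x0 y0 e; have y2 : 0 < y * y by nia.
  by rewrite -(pmulr_lgt0 _ y2); nia.
split; first by move=> e; rewrite e in x0.
have [|y [a [b [c [d [y0 e]]]]]] := @four_squares `|x|%N; first lia.
exists y, a, b, c, d; split; first exact/eqP.
by rewrite !ringE -e; congr (_ * _); rewrite natz; lia.
Qed.

Lemma NN_int (x : int) : NN (M := ring_struct int) x <-> 0 <= x.
Proof.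
rewrite /NN le0r Pos_int; split=> [[->|->]|/orP[/eqP|]]; rewrite ?eqxx ?orbT //; by [left|right].
Qed.

Lemma Rem_int (c m r : int) : Rem (M := ring_struct int) c m r <->
  0 <= r < m /\ r = (c %% m)%Z.
Proof.
split=> [[/NN_int r0 [[e [/Pos_int e0]]]]|[/andP[r0 rm] rE]].
  rewrite !ringE => <- [q ->]; rewrite !ringE; split; first lia.
  by rewrite modzMDl modz_small //; lia.
split; first exact/NN_int.
split; first by exists (m - r); split; [apply/Pos_int; lia|rewrite raddE; lia].
by exists (c %/ m)%Z; rewrite !ringE rE; exact: divz_eq.
Qed.

Lemma ExpN_int (x y z : int) : 0 <= y -> 0 <= z ->
  ExpN (M := ring_struct int) x y z <-> x = y ^+ `|z|%N.
Proof.
move=> y0 z0; split=> [[c [d [/NN_int d0 [c1 [cS cz]]]]]|->].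
  have H (n : nat) : n%:R <= z -> Rem (M := ring_struct int) c (modulus (M := ring_struct int) d n%:R) (y ^+ n).
    elim: n => [//|n IH] nz.
    rewrite exprSr -addn1 natrD; apply: (cS _ (z - n%:R)).
    - exact/NN_int.
    - by apply/Pos_int; lia.
    - by rewrite raddE; lia.
    - by apply: IH; lia.
  have /H : `|z|%N%:R <= z by lia.
  have -> : `|z|%N%:R = z by lia.
  by move: cz => /Rem_int[_ ->] /Rem_int[_ ->].
pose s i := (`|y| ^ i)%N.
have sE i : (s i)%:R = y ^+ i.
  by rewrite /s natrX; congr (_ ^+ _); lia.
have [c [d H]] := beta_code s `|z|%N.
have R (i : nat) : (i <= `|z|)%N -> Rem (M := ring_struct int) c%:R (modulus (M := ring_struct int) d%:R i%:R) (y ^+ i).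
  move=> /H[h1 h2]; rewrite /modulus !ringE -natrM -!natrD -sE; apply/Rem_int.
  rewrite !natz modz_nat h2; split=> //; move: h1; lia.
have zE : `|z|%N%:R = z by lia.
exists c%:R, d%:R; split; first exact/NN_int.
split; first exact: (R 0%N).
split; last by rewrite -[X in modulus _ X]zE; exact: R.
move=> i e r /NN_int i0 /Pos_int e0; rewrite raddE => iez.
have iE : `|i|%N%:R = i by lia.
have hi : (`|i|%N <= `|z|)%N by lia.
have hi' : (`|i|%N.+1 <= `|z|)%N by lia.
have := R _ hi; rewrite iE => /Rem_int[_ E] /Rem_int[_ ->]; rewrite -E.
have := R _ hi'; rewrite -addn1 natrD iE addn1 exprSr.
by [].
Qed.

Lemma Exp_int (x y z : int) :
  Exp (M := ring_struct int) x y z <-> 0 <= z /\ x = y ^+ `|z|%N.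
Proof.
have y2 : 0 <= y * y by nia.
split=> [[/NN_int z0 [t [/NN_int t0 H]]]|[z0 ->]].
  split=> //; case: H => -[<-]; rewrite !ringE.
    move=> /ExpN_int -> //; rewrite -expr2 -exprM; congr (_ ^+ _); lia.
  move=> [w [/ExpN_int -> // ->]]; rewrite rmulE -expr2 -exprM -exprSr; congr (_ ^+ _); lia.
split; first exact/NN_int.
exists (`|z|%N./2)%:R; split; first exact/NN_int.
have := odd_double_half `|z|%N; set h := (`|z|%N)./2; rewrite -muln2.
have hE : `|(h%:R : int)|%N = h by lia.
case: odd => e; [right|left]; (split; first by rewrite !ringE; lia).
  exists ((y * y) ^+ h); split; first by apply/ExpN_int; rewrite ?hE.
  by rewrite rmulE -expr2 -exprM -exprSr; congr (_ ^+ _); lia.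
by apply/ExpN_int; rewrite ?rmulE ?hE //= -expr2 -exprM; congr (_ ^+ _); lia.
Qed.

(** * Models of the theory of the integers *)

Definition ExpK (k : nat) (M : structure Lring) (p i : M) := Exp p (rnat M k) i.

Lemma def_ExpK (I : Type) (S : I -> structure Lring) k (s t : forall i, (nat -> S i) -> S i) :
  tdef s -> tdef t -> def (fun i rho => ExpK k (s i rho) (t i rho)).
Proof. by move=> ds dt; apply: def_Exp => //; exact: tdef_rnat. Qed.

Ltac rfo := repeat first [apply: def_ExpK | apply: def_Exp | apply: def_NN | apply: def_Pos | fo_step].

Section ModelsOfZ.
Variables (k : nat) (R : idomainType) (hR : ring_elem_equiv R int).
Implicit Types (i j m x : R).

Lemma ring_transfer (P : forall M : structure Lring, (nat -> M) -> Prop) :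
  def (S := fun M => M) P -> (forall rho, P (ring_struct int) rho) ->
  forall rho, P (ring_struct R) rho.
Proof.
move=> dP h; apply: (def_transfer (i := ring_struct int) dP) => // p sp.
exact: iff_sym (hR sp).
Qed.

Local Notation E := (@ExpK k (ring_struct R)).

Lemma ExpK_int (p i : int) : ExpK k (M := ring_struct int) p i <-> 0 <= i /\ p = k%:R ^+ `|i|%N.
Proof. by rewrite /ExpK rnatE; exact: Exp_int. Qed.

Lemma ExpK_fun p q i : E p i -> E q i -> p = q.
Proof.
apply: (@ring_transfer (fun M rho => ExpK k (rho 0%N) (rho 1%N) -> ExpK k (rho 2%N) (rho 1%N) ->
  rho 0%N = rho 2%N) _ _ (fun n => nth 0 [:: p; i; q] n)); first by rfo.
by move=> rho /ExpK_int[_ ->] /ExpK_int[_ ->].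
Qed.

Lemma ExpKD p q i j : E p i -> E q j -> E (p * q) (i + j).
Proof.
apply: (@ring_transfer (fun M rho => ExpK k (rho 0%N) (rho 1%N) -> ExpK k (rho 2%N) (rho 3%N) ->
  ExpK k (rmul (rho 0%N) (rho 2%N)) (radd (rho 1%N) (rho 3%N))) _ _
  (fun n => nth 0 [:: p; i; q; j] n)); first by rfo.
move=> rho /ExpK_int[h1 ->] /ExpK_int[h2 ->]; apply/ExpK_int; rewrite !ringE -exprD.
by split; [lia|congr (_ ^+ _); lia].
Qed.

Lemma ExpK_neq0 p i : (1 < k)%N -> E p i -> p != 0.
Proof.
move=> hk h; apply/eqP; move: h.
apply: (@ring_transfer (fun M rho => ExpK k (rho 0%N) (rho 1%N) -> ~ rho 0%N = rzero M) _ _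
  (fun n => nth 0 [:: p; i] n)); first by rfo.
by move=> rho /ExpK_int[h1 ->]; apply/eqP; rewrite expf_neq0 //; lia.
Qed.

Lemma ExpK0 : E 1 0.
Proof.
apply: (@ring_transfer (fun M rho => ExpK k (rone M) (rzero M)) _ _ (fun=> 0)); first by rfo.
by move=> rho; apply/ExpK_int; rewrite expr0.
Qed.

Lemma ExpK1 : E k%:R 1.
Proof.
rewrite -(rnatE R k); apply: (@ring_transfer (fun M rho => ExpK k (rnat M k) (rone M)) _ _ (fun=> 0)); first by rfo.
by move=> rho; apply/ExpK_int; rewrite rnatE.
Qed.

Lemma ExpK_total m : exists p, E p m \/ E p (- m).
Proof.
(* Negation is not in the ring language: [- m] is replaced by an element whose sum with [m] is
   zero. *)
suff [p [|[m' []]]] : exists p, E p m \/ exists m', m + m' = 0 /\ E p m'.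
- by exists p; left.
- by move=> /eqP; rewrite addrC addr_eq0 => /eqP ->; exists p; right.
apply: (@ring_transfer (fun M rho => exists p : M, ExpK k p (rho 0%N) \/
   exists m' : M, radd (rho 0%N) m' = rzero M /\ ExpK k p m') _ _ (fun=> m)); first by rfo.
move=> rho; exists (k%:R ^+ `|rho 0%N : int|%N).
have [h|h] := lerP 0 (rho 0%N : int); [left|right]; first exact/ExpK_int.
by exists (- (rho 0%N : int)); split; [rewrite !ringE subrr|apply/ExpK_int; split; [lia|congr (_ ^+ _); lia]].
Qed.

Lemma ExpK_NN i : NN (M := ring_struct R) i <-> exists p, E p i.
Proof.
apply: (@ring_transfer (fun M rho => NN (rho 0%N) <-> exists p : M, ExpK k p (rho 0%N)) _ _ (fun=> i)); first by rfo.
move=> rho; rewrite NN_int; split=> [h|[p /ExpK_int[]//]].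
by exists (k%:R ^+ `|rho 0%N : int|%N); apply/ExpK_int.
Qed.

(** Provides the common denominator for [crit]: the three exponents belong to the two summands and
    to the result. *)
Lemma ExpK_directed i j m : exists d e f p q r,
  [/\ E p d, E q e & E r f] /\ (i + d = j + e /\ i + d = m + f).
Proof.
suff [d [e [f [p [q [r [? [? [? ?]]]]]]]]] : exists d e f p q r,
    E p d /\ E q e /\ E r f /\ (i + d = j + e /\ i + d = m + f).
  by exists d, e, f, p, q, r.
apply: (@ring_transfer (fun M rho => exists d e f p q r : M, ExpK k p d /\ ExpK k q e /\ ExpK k r f /\
  (radd (rho 0%N) d = radd (rho 1%N) e /\ radd (rho 0%N) d = radd (rho 2%N) f)) _ _
  (fun n => nth 0 [:: i; j; m] n)); first by rfo.
move=> rho; have [x xE] : exists x : int, x = rho 0%N by exists (rho 0%N).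
have [y yE] : exists x : int, x = rho 1%N by exists (rho 1%N).
have [z zE] : exists x : int, x = rho 2%N by exists (rho 2%N).
rewrite -xE -yE -zE; pose I := `|x| + `|y| + `|z|.
exists (I - x), (I - y), (I - z), (k%:R ^+ `|(I - x)%R|%N), (k%:R ^+ `|(I - y)%R|%N), (k%:R ^+ `|(I - z)%R|%N).
by do 3! [split; first by apply/ExpK_int; split=> //; lia]; rewrite !ringE; lia.
Qed.

(** Agreement of two formulas at all assignments is itself a first-order statement, true in the
    integers. Hence all defining formulas give the same relation in [R]. *)
Lemma sat_defines_exp p : defines_exp p -> forall rho : nat -> R,
  sat (M := ring_struct R) rho p <-> Exp (M := ring_struct R) (rho 0%N) (rho 1%N) (rho 2%N).
Proof.
move=> [_ hp]; apply: (@ring_transfer (fun M rho => sat rho p <-> Exp (rho 0%N) (rho 1%N) (rho 2%N))).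
  by apply: def_equiv; [exists p|rfo].
by move=> rho; rewrite hp Exp_int.
Qed.

(** The specification inside [kpow] ranges over all defining formulas; one instance is required to
    recover the value from it. *)
Lemma ex_defines_exp : exists p, defines_exp p.
Proof.
have [||p [fp hp]] := @def_bounded _ _ (fun M : structure Lring => M)
  (fun M rho => Exp (rho 0%N) (rho 1%N) (rho 2%N)) 3.
- by rfo.
- by move=> M rho rho' e; rewrite !e.
- by exists p; split=> // rho; rewrite hp Exp_int.
Qed.

Lemma kpowE p i : E p i -> kpow k i = p.
Proof.
move=> h; rewrite /kpow; set Q := fun x : R => _.
have hQ : Q p by move=> f hf; apply/(sat_defines_exp hf); rewrite /= -(rnatE R k).
have [f hf] := ex_defines_exp.
have /(_ f hf)/(sat_defines_exp hf) := epsilon_spec (inhabits 0) Q (ex_intro _ p hQ).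
by rewrite /= -(rnatE R k) => /ExpK_fun; apply.
Qed.

Lemma rposE i : rpos i <-> Pos (M := ring_struct R) i.
Proof.
have H p : defines_pos p -> forall rho : nat -> R, sat (M := ring_struct R) rho p <-> Pos (M := ring_struct R) (rho 0%N).
  move=> [_ hp]; apply: (@ring_transfer (fun M rho => sat rho p <-> Pos (rho 0%N))).
    by apply: def_equiv; [exists p|rfo].
  by move=> rho; rewrite hp Pos_int.
have [||p [fp hp]] := @def_bounded _ _ (fun M : structure Lring => M) (fun M rho => Pos (rho 0%N)) 1.
- by rfo.
- by move=> M rho rho' e; rewrite !e.
split=> [h|h f hf]; last exact/(H f hf).
suff hp' : defines_pos p by apply/(H p hp' (fun=> i))/h.
split; last by move=> rho; rewrite hp Pos_int.
by apply: fv_mono fp => -[].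
Qed.
End ModelsOfZ.

(** * Groups coordinatized by a ring *)

Declare Scope gstr_scope.
Delimit Scope gstr_scope with gs.
Notation "x * y" := (gmul x y) : gstr_scope.
Notation "x ^-1" := (ginv x) : gstr_scope.
Notation "1" := (gone _) : gstr_scope.

Section GroupLaws.
Variables (G : group_str) (hG : is_group G).
Implicit Types x y z : gcar G.
Local Open Scope gstr_scope.

Lemma gmulA x y z : x * (y * z) = x * y * z. Proof. by case: hG. Qed.
Lemma gmul1 x : 1 * x = x. Proof. by case: hG. Qed.
Lemma gmulV x : x^-1 * x = 1. Proof. by case: hG. Qed.

Lemma gmulrV x : x * x^-1 = 1.
Proof.
by rewrite -[x * x^-1]gmul1 -(gmulV x^-1) gmulA -[x^-1^-1 * x^-1 * x]gmulA gmulV -gmulA gmul1.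
Qed.
Lemma gmulr1 x : x * 1 = x. Proof. by rewrite -(gmulV x) gmulA gmulrV gmul1. Qed.
Lemma gmulKV x y : x^-1 * (x * y) = y. Proof. by rewrite gmulA gmulV gmul1. Qed.
Lemma gmulK x y : x * (x^-1 * y) = y. Proof. by rewrite gmulA gmulrV gmul1. Qed.
Lemma gmulrK x y : y * x * x^-1 = y. Proof. by rewrite -gmulA gmulrV gmulr1. Qed.
Lemma gmulrKV x y : y * x^-1 * x = y. Proof. by rewrite -gmulA gmulV gmulr1. Qed.
Lemma gmulI x y z : x * y = x * z -> y = z.
Proof. by move=> e; rewrite -(gmulKV x y) e gmulKV. Qed.
Lemma gmulIr x y z : y * x = z * x -> y = z.
Proof. by move=> e; rewrite -(gmulrK x y) e gmulrK. Qed.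
Lemma ginv_uniq x y : x * y = 1 -> y = x^-1.
Proof. by move=> e; apply: (@gmulI x); rewrite e gmulrV. Qed.
Lemma ginvM x y : (x * y)^-1 = y^-1 * x^-1.
Proof. by apply/esym/ginv_uniq; rewrite -gmulA gmulK gmulrV. Qed.
Lemma ginvK x : x^-1^-1 = x.
Proof. by apply/esym/ginv_uniq; rewrite gmulV. Qed.
Lemma ginv1 : (1 : gcar G)^-1 = 1.
Proof. by apply/esym/ginv_uniq; rewrite gmul1. Qed.
End GroupLaws.

Section HomLaws.
Variables (G H : group_str) (hG : is_group G) (hH : is_group H).
Variables (f : gcar G -> gcar H) (fM : group_hom f).
Lemma ghom1 : f 1%gs = 1%gs.
Proof. by apply: (gmulI hH (x := f 1%gs)); rewrite -fM gmul1 // gmulr1. Qed.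
Lemma ghomV x : f (x^-1)%gs = ((f x)^-1)%gs.
Proof. by apply: ginv_uniq => //; rewrite -fM gmulrV // ghom1. Qed.
End HomLaws.

(* [al n] and [be m] play the roles of [a ^ n] and [b ^ m] with exponents in [R]. *)
Record frame (k : nat) (G : group_str) (R : nzRingType) (al be : R -> gcar G) : Prop := Frame {
  frame_group : is_group G;
  frame_al : forall x y, al (x + y) = (al x * al y)%gs;
  frame_be : forall x y, be (x + y) = (be x * be y)%gs;
  frame_conj : forall p i n, ExpK k (M := ring_struct R) p i ->
    (be (- i) * al n * be i)%gs = al (n * p);
  frame_gen : forall g, exists n i m, g = (be i * al n * be (- i) * be m)%gs;
  frame_free : forall n m, (al n * be m)%gs = 1%gs -> n = 0 /\ m = 0 }.

Section BSkFrame.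
Variables (k : nat) (hk : (1 < k)%N) (R : idomainType) (hR : ring_elem_equiv R int).
Implicit Types (i j m n p q : R).
Local Notation E := (@ExpK k (ring_struct R)).
Local Notation iota := (@FracField.tofrac R).
Local Notation kappa := (@kinvpow R k).

Lemma iota_neq0 p i : E p i -> iota p != 0.
Proof. by move=> h; rewrite tofrac_eq0 (ExpK_neq0 hR hk h). Qed.

(** Every element of [R] is a difference of exponents on which [ExpK] is defined. In this form the
    sign distinction in [kinvpow] disappears and additivity is inherited from [ExpK]. *)
Lemma kinvpow_frac p q i j : E p i -> E q j -> kappa (i - j) = iota q / iota p.
Proof.
move=> pi qj; have [p0 q0] := (iota_neq0 pi, iota_neq0 qj).
have pos r : E r (i - j) -> (iota (kpow k (i - j)))^-1 = iota q / iota p.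
  move=> hr; rewrite (kpowE hR hr); have qr := ExpKD hR qj hr.
  rewrite addrC subrK in qr; rewrite (ExpK_fun hR pi qr).
  by rewrite rmorphM invfM mulrA divff // mul1r.
rewrite /kinvpow; case: excluded_middle_informative => [h|h].
  have /(ExpK_NN k hR)[r /pos//] : NN (M := ring_struct R) (i - j).
  by case: h => [->|/(rposE hR)]; [left|right].
have [r [hr|]] := ExpK_total k hR (i - j).
  case: h; have /(ExpK_NN k hR)[|] : exists r, E r (i - j) by exists r.
    by left.
  by move=> /(rposE hR); right.
move=> hr; rewrite (kpowE hR hr).
have pr := ExpKD hR pi hr.
rewrite opprB addrC subrK in pr; rewrite (ExpK_fun hR qj pr).
by rewrite rmorphM mulrC mulKf.
Qed.

Lemma ExpK_diff m : exists p q i j, [/\ E p i, E q j & m = i - j].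
Proof.
have E0 := ExpK0 k hR; have [p [h|h]] := ExpK_total k hR m.
  by exists p, 1, m, 0; rewrite subr0.
by exists 1, p, 0, (- m); rewrite opprK add0r.
Qed.

Lemma kinvpowD m n : kappa (m + n) = kappa m * kappa n.
Proof.
have [p [q [i [j [pi qj ->]]]]] := ExpK_diff m.
have [p' [q' [i' [j' [pi' qj' ->]]]]] := ExpK_diff n.
have -> : i - j + (i' - j') = (i + i') - (j + j') by rewrite opprD addrACA.
rewrite (kinvpow_frac (ExpKD hR pi pi') (ExpKD hR qj qj')).
rewrite (kinvpow_frac pi qj) (kinvpow_frac pi' qj') !rmorphM mulf_div //.
Qed.

Lemma kinvpow0 : kappa 0 = 1.
Proof.
by have := kinvpow_frac (ExpK0 k hR) (ExpK0 k hR); rewrite subr0 divff // rmorph1 oner_neq0.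
Qed.

Lemma in_locP (x : {fraction R}) : in_loc k x <-> exists a p i, E p i /\ x = iota a / iota p.
Proof.
split=> [[a [s [[->|[i [/(rposE hR) hi ->]]] ->]]]|[a [p [i [pi ->]]]]].
- by exists a, 1, 0; split=> //; exact: ExpK0.
- have /(ExpK_NN k hR)[p pi] : NN (M := ring_struct R) i by right.
  by exists a, p, i; rewrite (kpowE hR pi).
exists a, p; split=> //; have /(ExpK_NN k hR)[i0|/(rposE hR) i0] : exists p, E p i by exists p.
  by left; apply: (ExpK_fun hR pi); rewrite i0; exact: ExpK0.
by right; exists i; rewrite (kpowE hR pi).
Qed.

Lemma in_locD (x y : {fraction R}) : in_loc k x -> in_loc k y -> in_loc k (x + y).
Proof.
move=> /in_locP[a [p [i [pi ->]]]] /in_locP[b [q [j [qj ->]]]]; apply/in_locP.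
exists (a * q + b * p), (p * q), (i + j); split; first exact: ExpKD.
by rewrite rmorphD !rmorphM addf_div ?(iota_neq0 pi) ?(iota_neq0 qj).
Qed.

Lemma in_locN (x : {fraction R}) : in_loc k x -> in_loc k (- x).
Proof. by move=> [a [s [hs ->]]]; exists (- a), s; rewrite rmorphN mulNr. Qed.

Lemma in_locZ (x : {fraction R}) m : in_loc k x -> in_loc k (x * kappa m).
Proof.
move=> /in_locP[a [p [i [pi ->]]]]; have [q [r [j [l [qj rl ->]]]]] := ExpK_diff m.
apply/in_locP; exists (a * r), (p * q), (i + j); split; first exact: ExpKD.
by rewrite (kinvpow_frac qj rl) mulf_div !rmorphM.
Qed.

Lemma in_loc_iota n : in_loc k (iota n).
Proof. by exists n, 1; split; [left|rewrite rmorph1 divr1]. Qed.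

Lemma to_locK (x : {fraction R}) : in_loc k x -> sval (to_loc k x) = x.
Proof. by rewrite /to_loc; case: excluded_middle_informative. Qed.

Lemma loc_inj (x y : loc R k) : sval x = sval y -> x = y.
Proof. by case: x y => [x hx] [y hy] /= e; subst y; congr exist; exact: Prop_irrelevance. Qed.

Lemma BSk_frame : @frame k (BSk k R) R (fun n => (to_loc k (iota n), 0)) (fun m => (exist _ 0 (in_loc0 R k), m)).
Proof.
have lP (x : loc R k) : in_loc k (sval x) by case: x.
have inD := in_locD; have inZ := in_locZ; have inN := in_locN; have inI := in_loc_iota.
split=> /=.
- split=> /= [[x1 m1] [x2 m2] [x3 m3]|[x m]|[x m]] /=; congr (_, _).
  + by apply: loc_inj; rewrite !to_locK /=; first (by rewrite kinvpowD; ring); auto 10.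
  + by rewrite addrA.
  + by apply: loc_inj; rewrite to_locK /= add0r ?kinvpow0 ?mulr1.
  + by rewrite add0r.
  + by apply: loc_inj; rewrite !to_locK /=; auto; rewrite addNr.
  + by rewrite addNr.
- move=> x y; congr (_, _); last by rewrite addr0.
  by apply: loc_inj; rewrite !to_locK // ?kinvpow0 ?mulr1 ?rmorphD //; auto.
- by move=> x y; congr (_, _); apply: loc_inj; rewrite to_locK /= mul0r addr0 //; exact: in_loc0.
- move=> p i n pi; congr (_, _); last by rewrite addr0 addNr.
  have ki : kappa (- i) = iota p.
    by have := kinvpow_frac (ExpK0 k hR) pi; rewrite sub0r rmorph1 divr1.
  apply: loc_inj; rewrite !(mul0r, addr0, add0r) !to_locK; auto.
  by rewrite ki rmorphM.
- move=> [x m]; have /in_locP[a [p [i [pi xE]]]] := lP x.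
  exists a, i, m; congr (_, _); last by rewrite addr0 subrr add0r.
  have ki : kappa i = (iota p)^-1.
    by have := kinvpow_frac pi (ExpK0 k hR); rewrite subr0 rmorph1 mul1r.
  apply: loc_inj; rewrite !(mul0r, addr0, add0r) !to_locK; auto.
  by rewrite ki.
- move=> n m [/(congr1 sval)]; rewrite mul0r addr0 !to_locK //= => /eqP; rewrite tofrac_eq0 => /eqP ->.
  by rewrite add0r.
Qed.
End BSkFrame.

(* Multiplication of the elements [n_j k^(-i_j) b^(m_j)], over a common denominator. *)
Definition crit (k : nat) (M : structure Lring) (n1 i1 m1 n2 i2 m2 n3 i3 m3 : M) :=
  m3 = radd m1 m2 /\ exists d1 d2 d3 p1 p2 p3,
    ExpK k p1 d1 /\ ExpK k p2 d2 /\ ExpK k p3 d3 /\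
    radd i1 d1 = radd i3 d3 /\ radd (radd m1 i2) d2 = radd i3 d3 /\
    radd (rmul n1 p1) (rmul n2 p2) = rmul n3 p3.

(** In [Z[1/k] x| Z] this is [(n k^(-i), m)]. The triple is not unique: [(n, i)] may be replaced by
    [(n k^d, i + d)]. *)
Definition theta (G : group_str) (R : nzRingType) (al be : R -> gcar G) (n i m : R) :=
  (be i * al n * be (- i) * be m)%gs.

Section FrameTheory.
Variables (k : nat) (G : group_str) (R : idomainType) (hR : ring_elem_equiv R int).
Variables (al be : R -> gcar G) (F : frame k al be).
Implicit Types (n i m p d x y : R).
Let hG := frame_group F.
Let alD := frame_al F.
Let beD := frame_be F.
Local Notation E := (@ExpK k (ring_struct R)).
Local Notation th := (@theta G R al be).
Local Open Scope gstr_scope.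

Lemma frame_be0 : be 0 = 1.
Proof. by apply: (@gmulI _ hG (be 0)); rewrite -beD addr0 gmulr1. Qed.
Lemma frame_beN m : be (- m) = (be m)^-1.
Proof. by apply: ginv_uniq => //; rewrite -beD subrr frame_be0. Qed.
Lemma frame_al0 : al 0 = 1.
Proof. by apply: (@gmulI _ hG (al 0)); rewrite -alD addr0 gmulr1. Qed.
Lemma frame_alN m : al (- m) = (al m)^-1.
Proof. by apply: ginv_uniq => //; rewrite -alD subrr frame_al0. Qed.

Let cj i n := be i * al n * be (- i).

Lemma cjD i x y : cj i (x + y)%R = cj i x * cj i y.
Proof. by rewrite /cj alD frame_beN !gmulA // gmulrKV. Qed.

Lemma be_cj m i n : be m * cj i n = cj (m + i)%R n * be m.
Proof. by rewrite /cj -!gmulA // -beD opprD [(- m - i)%R]addrC addrNK !gmulA // -beD. Qed.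

Lemma cj_shift i n p d : E p d -> cj i n = cj (i + d)%R (n * p)%R.
Proof.
move=> hp; rewrite /cj -(frame_conj F n hp) opprD [(- i - d)%R]addrC !beD !frame_beN.
by rewrite !gmulA // !gmulrK.
Qed.

Lemma theta_cj n i m : th n i m = cj i n * be m. Proof. by []. Qed.

Lemma cj_inj i x y m m' : cj i x * be m = cj i y * be m' -> x = y /\ m = m'.
Proof.
have c z u : cj i z * be u = be i * (al z * be u) * be (- i).
  by rewrite /cj -!gmulA // -!beD [(- i + u)%R]addrC.
rewrite !c => /(gmulIr hG)/(gmulI hG) e.
have /(frame_free F)[] : al (- y + x)%R * be (m - m')%R = 1.
  by rewrite alD beD gmulA // -[_ * be m]gmulA // e !frame_alN !frame_beN gmulKV // gmulrV.
by move=> /eqP; rewrite addrC subr_eq0 => /eqP -> /eqP; rewrite subr_eq0 => /eqP.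
Qed.

(** Both factors are rewritten over conjugates by the same power of [be], where the [al] parts add.
    The criterion mentions [R] alone, so it interprets the group in the ring. *)
Lemma theta_mul n1 i1 m1 n2 i2 m2 n3 i3 m3 :
  th n1 i1 m1 * th n2 i2 m2 = th n3 i3 m3 <->
  crit k (M := ring_struct R) n1 i1 m1 n2 i2 m2 n3 i3 m3.
Proof.
have mulE d1 d2 p1 p2 : E p1 d1 -> E p2 d2 -> (i1 + d1 = m1 + i2 + d2)%R ->
    th n1 i1 m1 * th n2 i2 m2 = cj (i1 + d1) (n1 * p1 + n2 * p2)%R * be (m1 + m2)%R.
  move=> h1 h2 e; rewrite !theta_cj gmulA // -[_ * be m1 * _]gmulA // be_cj cjD.
  by rewrite -(cj_shift i1 n1 h1) e -(cj_shift _ n2 h2) beD !gmulA.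
split=> [e|[-> [d1 [d2 [d3 [p1 [p2 [p3 [h1 [h2 [h3 []]]]]]]]]]]].
  have [d1 [d2 [d3 [p1 [p2 [p3 [[h1 h2 h3] [e1 e2]]]]]]]] := ExpK_directed k hR i1 (m1 + i2)%R i3.
  move: e; rewrite (mulE _ _ _ _ h1 h2 e1) theta_cj (cj_shift i3 n3 h3) -e2.
  move=> /cj_inj[en em]; split; first by [].
  by exists d1, d2, d3, p1, p2, p3; do 5! split=> //; exact: etrans (esym e1) e2.
move=> e1 [e2 e3]; rewrite ?ringE in e1 e2 e3 *; rewrite (mulE _ _ _ _ h1 h2); last by rewrite e1 e2.
by rewrite e1 e3 -(cj_shift i3 n3 h3).
Qed.

Lemma theta_surj g : exists n i m, g = th n i m.
Proof. by have [n [i [m ->]]] := frame_gen F g; exists n, i, m. Qed.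

Lemma theta_one : th 0 0 0 = 1.
Proof. by rewrite /theta oppr0 frame_al0 frame_be0 !gmul1. Qed.

(** Equality of coordinates is the product criterion with the identity as second factor. *)
Lemma theta_eq n i m n' i' m' : th n i m = th n' i' m' <->
  crit k (M := ring_struct R) n i m 0 0 0 n' i' m'.
Proof. by rewrite -theta_mul theta_one gmulr1. Qed.

End FrameTheory.

(** Matching equal coordinates is well defined and injective because [theta_eq] gives the same
    criterion in both groups; [theta_mul] makes it multiplicative. *)
Lemma frame_uniq k (R : idomainType) (G H : group_str) (al be : R -> gcar G) (al' be' : R -> gcar H) :
  ring_elem_equiv R int -> frame k al be -> frame k al' be' -> group_iso G H.
Proof.
move=> hR F F'.
have ex g : exists t : R * R * R, g = theta al be t.1.1 t.1.2 t.2.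
  by have [n [i [m ->]]] := theta_surj F g; exists (n, i, m).
have [c hc] := choice ex; pose f g := theta al' be' (c g).1.1 (c g).1.2 (c g).2.
have fE n i m : f (theta al be n i m) = theta al' be' n i m.
  by apply/(theta_eq hR F')/(theta_eq hR F); rewrite -hc.
have fM x y : f (gmul x y) = gmul (f x) (f y).
  have [n [i [m ->]]] := theta_surj F x; have [n' [i' [m' ->]]] := theta_surj F y.
  have [n2 [i2 [m2 e]]] := theta_surj F (gmul (theta al be n i m) (theta al be n' i' m')).
  by rewrite e !fE; apply/esym/(theta_mul hR F')/(theta_mul hR F).
have [hG hH] := (frame_group F, frame_group F').
exists f; split=> //; last exact: ghom1; last exact: ghomV.
have ex' g : exists x, g = f x.
  by have [n [i [m ->]]] := theta_surj F' g; exists (theta al be n i m); rewrite fE.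
have [d hd] := choice ex'; exists d => // x; apply: esym.
have := hd (f x); move: (d (f x)) => y.
have [n [i [m ->]]] := theta_surj F x; have [n' [i' [m' ->]]] := theta_surj F y.
by rewrite !fE => /(theta_eq hR F')/(theta_eq hR F).
Qed.

Section RingIso.
Variables (R R' : idomainType) (phi : R -> R').
Hypotheses (phi_bij : bijective phi) (phiD : forall x y, phi (x + y) = phi x + phi y)
  (phiM : forall x y, phi (x * y) = phi x * phi y) (phi1 : phi 1 = 1).

Lemma ring_iso_sat (P : forall M : structure Lring, (nat -> M) -> Prop) :
  def (S := fun M => M) P -> forall rho : nat -> R,
  P (ring_struct R) rho <-> P (ring_struct R') (fun n => phi (rho n)).
Proof.
move=> [p hp] rho; rewrite -!hp; apply: (@sat_iso _ (ring_struct R) (ring_struct R') phi).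
- by case: phi_bij => psi _ psiK y; exists (psi y); rewrite psiK.
- exact: bij_inj.
- case=> a //=; by apply: (@addrI _ (phi 0)); rewrite -phiD !addr0.
Qed.

Lemma frame_transport k (G : group_str) (al be : R -> gcar G) psi :
  cancel psi phi -> frame k al be -> frame k (fun x => al (psi x)) (fun x => be (psi x)).
Proof.
move=> psiK F; have hi := bij_inj phi_bij.
have psiD x y : psi (x + y) = psi x + psi y by apply: hi; rewrite phiD !psiK.
have psi0 : psi 0 = 0 by apply: (@addrI _ (psi 0)); rewrite -psiD !addr0.
have psiN x : psi (- x) = - psi x by apply/eqP; rewrite -subr_eq0 opprK -psiD addNr psi0.
split; first exact: frame_group F.
- by move=> x y; rewrite psiD (frame_al F).
- by move=> x y; rewrite psiD (frame_be F).
- move=> p i n hp; have -> : psi (n * p) = psi n * psi p by apply: hi; rewrite phiM !psiK.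
  rewrite psiN; apply: (frame_conj F).
  have := @ring_iso_sat (fun M rho => ExpK k (rho 0%N) (rho 1%N)) ltac:(rfo) (fun n => nth 0 [:: psi p; psi i] n).
  by rewrite /= !psiK => ->.
- move=> g; have [n [i [m ->]]] := frame_gen F g; have [psi' _ psi'K] := phi_bij.
  have pK x : psi (phi x) = x by apply: hi; rewrite psiK.
  by exists (phi n), (phi i), (phi m); rewrite psiN !pK.
- move=> n m /(frame_free F)[/(congr1 phi) + /(congr1 phi)]; rewrite !psiK.
  by rewrite -psi0 psiK.
Qed.
End RingIso.

(** * Translation of group formulas into ring formulas *)

Record framed (k : nat) := Framed {
  fgroup : group_str;
  fring : idomainType;
  fringP : ring_elem_equiv fring int;
  fal : fring -> gcar fgroup;
  fbe : fring -> gcar fgroup;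
  framedP : frame k fal fbe }.

Section Interpretation.
Variable k : nat.
Local Notation S := (fun F : framed k => ring_struct (fring F)).
Definition fth (F : framed k) : fring F -> fring F -> fring F -> gcar (fgroup F) :=
  theta (@fal _ F) (@fbe _ F).
Definition fenv (F : framed k) (rho : nat -> fring F) : nat -> group_struct (fgroup F) :=
  fun n => fth (rho (n * 3)%N) (rho (n * 3).+1) (rho (n * 3).+2).

Lemma fth_surj (F : framed k) g : exists n i m, g = fth (F := F) n i m.
Proof. exact: (theta_surj (framedP F)). Qed.

Lemma fenv_surj (F : framed k) (e : nat -> gcar (fgroup F)) :
  exists rho : nat -> fring F, fenv rho = e.
Proof.
have /choice[c hc] : forall n, exists t : fring F * fring F * fring F, e n = fth t.1.1 t.1.2 t.2.
  by move=> n; have [x [y [z ->]]] := fth_surj (e n); exists (x, y, z).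
exists (fun j => let t := c (j %/ 3)%N in
  if (j %% 3 == 0)%N then t.1.1 else if (j %% 3 == 1)%N then t.1.2 else t.2).
apply: funext => n; rewrite hc /fenv.
have [-> -> ->] : [/\ (n * 3 %/ 3 = n)%N, ((n * 3).+1 %/ 3 = n)%N & ((n * 3).+2 %/ 3 = n)%N].
  by split; lia.
have [-> -> ->] : [/\ (n * 3 %% 3 = 0)%N, ((n * 3).+1 %% 3 = 1)%N & ((n * 3).+2 %% 3 = 2)%N].
  by split; lia.
by [].
Qed.

Lemma def_fth_mul a1 a2 a3 a4 a5 a6 a7 a8 a9 :
  def (S := S) (fun F rho => gmul (fth (F := F) (rho a1) (rho a2) (rho a3))
    (fth (rho a4) (rho a5) (rho a6)) = fth (rho a7) (rho a8) (rho a9)).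
Proof.
apply: (@def_iff _ _ S (fun F rho => crit k (rho a1) (rho a2) (rho a3)
  (rho a4) (rho a5) (rho a6) (rho a7) (rho a8) (rho a9))).
  by move=> F rho; apply: iff_sym; exact: (theta_mul (fringP F) (framedP F)).
by rewrite /crit; rfo.
Qed.

(** Slots 2, 1, 0 hold the coordinates of the value, in this order because each new quantifier
    enters at slot 0; the translated assignment starts at slot 3. *)
Lemma def_fth_eval t : def (S := S) (fun F rho => fth (F := F) (rho 2%N) (rho 1%N) (rho 0%N) =
  eval (fenv (F := F) (fun j => rho j.+3)) t).
Proof.
have th1 F : gone (fgroup F) = fth (F := F) 0 0 0 by rewrite /fth (theta_one (framedP F)).
elim: t => [n|f a IH].
  (* An equation between group elements is written as a multiplication by the identity, with all
     coordinates [o = 0], so that [def_fth_mul] covers it. *)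
  apply: (@def_iff _ _ S (fun F rho => exists o : S F, o = rzero (S F) /\
    gmul (fth (F := F) (rho 2%N) (rho 1%N) (rho 0%N)) (fth (F := F) o o o) =
    fth (F := F) (rho (n * 3).+3) (rho (n * 3).+4) (rho (n * 3).+4.+1))).
    have hG F : is_group (fgroup F) := frame_group (framedP F).
    by move=> F rho; split=> [[o [-> ]]|/= ->]; rewrite ?rzeroE -?th1 ?gmulr1 //; exists 0; rewrite -th1 gmulr1.
  apply: def_ex; apply: def_and; first by rfo.
  exact: (def_fth_mul 3 2 1 0 0 0 (n * 3).+4 (n * 3).+4.+1 (n * 3).+4.+2).
case: f a IH => a IH /=.
- apply: (@def_iff _ _ S (fun F rho => exists x y z, fth (F := F) x y z =
     eval (fenv (F := F) (fun j => rho j.+3)) (a ord0) /\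
     exists x' y' z', fth (F := F) x' y' z' =
     eval (fenv (F := F) (fun j => rho j.+3)) (a ord_max) /\
     gmul (fth (F := F) x y z) (fth (F := F) x' y' z') = fth (F := F) (rho 2%N) (rho 1%N) (rho 0%N))).
    move=> F rho; split=> [[x [y [z [-> [x' [y' [z' [-> ->]]]]]]]] //|->].
    have [x [y [z e]]] := fth_surj (eval (fenv (F := F) (fun j => rho j.+3)) (a ord0)).
    have [x' [y' [z' e']]] := fth_surj (eval (fenv (F := F) (fun j => rho j.+3)) (a ord_max)).
    by exists x, y, z; split=> //; exists x', y', z'; split; rewrite // e e'.
  do 3! apply: def_ex; apply: def_and.
    (* The value of the subterm occupies slots 0 to 2, the outer value now sits in 3 to 5, and the
       assignment starts at 6. *)
    exact: (def_rename (fun j => if j is j'.+3 then j'.+3.+3 else j) (IH ord0)).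
  do 3! apply: def_ex; apply: def_and.
    exact: (def_rename (fun j => if j is j'.+3 then j'.+3.+3.+3 else j) (IH ord_max)).
  exact: (def_fth_mul 5 4 3 2 1 0 8 7 6).
- apply: (@def_iff _ _ S (fun F rho => exists x y z, fth (F := F) x y z =
     eval (fenv (F := F) (fun j => rho j.+3)) (a ord0) /\
     exists o : S F, o = rzero (S F) /\
     gmul (fth (F := F) x y z) (fth (F := F) (rho 2%N) (rho 1%N) (rho 0%N)) = fth (F := F) o o o)).
    move=> F rho; have hG := frame_group (framedP F).
    split=> [[x [y [z [-> [o [->]]]]]]|->]; first by rewrite rzeroE -th1; exact: ginv_uniq.
    have [x [y [z e]]] := fth_surj (eval (fenv (F := F) (fun j => rho j.+3)) (a ord0)).
    by exists x, y, z; split=> //; exists 0; rewrite -th1 -e gmulrV.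
  do 3! apply: def_ex; apply: def_and.
    exact: (def_rename (fun j => if j is j'.+3 then j'.+3.+3 else j) (IH ord0)).
  apply: def_ex; apply: def_and; first by rfo.
  exact: (def_fth_mul 3 2 1 6 5 4 0 0 0).
- apply: (@def_iff _ _ S (fun F rho => exists o : S F, o = rzero (S F) /\
    gmul (fth (F := F) (rho 2%N) (rho 1%N) (rho 0%N)) (fth (F := F) o o o) = fth (F := F) o o o)).
    have hG F : is_group (fgroup F) := frame_group (framedP F).
    by move=> F rho; split=> [[o [-> ]]|/= ->]; rewrite ?rzeroE -?th1 ?gmulr1 //; exists 0; rewrite -th1 gmulr1.
  apply: def_ex; apply: def_and; first by rfo.
  exact: (def_fth_mul 3 2 1 0 0 0 0 0 0).
Qed.

(** One ring formula serves all framed groups, whatever their ring; this uniformity lets elementary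
    equivalence pass from rings to groups. A group quantifier becomes three ring quantifiers, by
    surjectivity of [fth]. *)
Lemma def_framed (P : forall M : structure Lgroup, (nat -> M) -> Prop) :
  def (S := fun M => M) P ->
  def (S := S) (fun F rho => P (group_struct (fgroup F)) (fenv rho)).
Proof.
case=> p hp; apply: (@def_iff _ _ S (fun F rho => sat (M := group_struct (fgroup F)) (fenv rho) p)).
  by move=> F rho; exact: hp.
elim: p {hp} => [|s t|p IHp q IHq|n p IH] /=.
- exact: def_False.
- apply: (@def_iff _ _ S (fun F rho => exists x y z, fth (F := F) x y z = eval (fenv rho) s /\
    fth (F := F) x y z = eval (fenv rho) t)).
    move=> F rho; split=> [[x [y [z [<- <-]]]]//|e].
    by have [x [y [z h]]] := fth_surj (eval (fenv rho) s); exists x, y, z; rewrite -h -e.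
  by do 3! apply: def_ex; apply: def_and; [exact: (def_fth_eval s)|exact: (def_fth_eval t)].
- exact: def_imp.
- apply: (def_iff _ (def_allN (n * 3) (def_allN (n * 3).+1 (def_allN (n * 3).+2 IH)))) => F rho.
  have e x y z : fenv (upd (upd (upd rho (n * 3) x) (n * 3).+1 y) (n * 3).+2 z) =
      upd (fenv rho) n (fth x y z).
    apply: funext => m; rewrite /fenv /upd; have [->|/eqP nm] := eqVneq m n.
      by rewrite !eqxx; do !case: ifP => //; lia.
    by do !case: ifP => //; lia.
  split=> [h g|h x y z]; last by rewrite e.
  by have [x [y [z ->]]] := fth_surj g; rewrite -e.
Qed.

End Interpretation.

Lemma frame_elem_equiv k (F F' : framed k) : group_elem_equiv (fgroup F) (fgroup F').
Proof.
have half (A B : framed k) (p : formula Lgroup) :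
    holds (group_struct (fgroup A)) p -> holds (group_struct (fgroup B)) p.
  move=> h rho; have [r <-] := fenv_surj rho.
  have dp : def (S := fun M : structure Lgroup => M) (fun M rho => sat rho p) by exists p.
  have eAB : elem_equiv (ring_struct (fring A)) (ring_struct (fring B)).
    by move=> q sq; rewrite (fringP A sq) (fringP B sq).
  exact: (def_transfer (i := A) (j := B) (def_framed k dp) eAB (fun r' => h (fenv r')) r).
by move=> p _; split; exact: half.
Qed.

(** * The integers inside the group *)

Section GroupLanguage.
Variables (k : nat) (M : structure Lgroup) (u v : M).
Implicit Types x y z w c m n s : M.

Definition mg x y : M := op2 (GMul : Defs.fsym Lgroup) x y.
Definition ig x : M := op1 (GInv : Defs.fsym Lgroup) x.
Definition eg : M := @interp Lgroup M GOne (fun i => match notF (ltn_ord i) with end).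
Fixpoint pg x (n : nat) : M := if n is n'.+1 then mg x (pg x n') else eg.

Definition cen x y := mg x y = mg y x.
Definition cjg w c := mg (mg (ig c) w) c.
Definition com w c := mg (cjg w c) (ig w).

(* In [Z[1/k] x| Z] with [u] in the normal part and [v] a complement: the
   centralizer of [v] is a copy of [Z], and [(k^m - 1) | (k^n - 1)] says [m | n]. *)
Definition Div m n := forall w, cen w u -> exists z, cen z u /\ com w n = com z m.

(* [s = n (n + 1)], after Robinson: the least common multiple of [n] and [n + 1]
   with the sign fixed by congruences for [s - 2] and [s - 6]. *)
Definition Sq n s := Div n s /\ Div (mg n v) s /\
  (forall t, cen t v -> Div n t -> Div (mg n v) t -> Div s t) /\
  Div (mg n (ig v)) (mg s (pg (ig v) 2)) /\
  Div (mg n (pg v 2)) (mg s (pg (ig v) 2)) /\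
  Div (mg n (pg (ig v) 2)) (mg s (pg (ig v) 6)).

(** Polarization: with [s(n) = n (n + 1)] one has [s(x + y) = s(x) + s(y) + 2 x y]. *)
Definition Mul x y z := exists p q r, cen p v /\ cen q v /\ cen r v /\
  Sq (mg x y) p /\ Sq x q /\ Sq y r /\ p = mg (mg z z) (mg q r).

(* [w = u ^ n]: [w (k^c - 1) = u (k^(c n) - 1)] modulo [(k^c - 1)^2] for all [c]. *)
Definition Pow n w := cen w u /\ forall c s, cen c v -> c <> eg -> cen s v -> Mul c n s ->
  exists z, cen z u /\ com w c = mg (com u s) (com (com z c) c).

Definition BSrel := cjg u v = pg u k /\ u <> eg.

(** In the standard group [BSrel] allows [u] to be any nonzero element of [Z[1/k]]. The second
    clause, applied to the element 1 of [Z[1/k]], makes [u] a divisor of a power of [k], hence a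
    unit. *)
Definition BSgen := BSrel /\ forall w, cen w u ->
  exists i n, cen i v /\ cen n v /\ Pow n (cjg w i).
End GroupLanguage.
Arguments mg : simpl never.
Arguments ig : simpl never.
Arguments eg : simpl never.

Section GroupDefinability.
Variables (I : Type) (S : I -> structure Lgroup).
Implicit Types s t r u v : forall i, (nat -> S i) -> S i.

Lemma tdef_mg s t : tdef s -> tdef t -> tdef (fun i rho => mg (s i rho) (t i rho)).
Proof. exact: tdef_op2. Qed.
Lemma tdef_ig s : tdef s -> tdef (fun i rho => ig (s i rho)).
Proof. by move=> [s' hs]; exists (@App Lgroup GInv (fun=> s')) => i rho /=; rewrite hs. Qed.
Lemma tdef_eg : tdef (fun i (rho : nat -> S i) => eg (S i)).
Proof.
exists (@App Lgroup GOne (fun i => match notF (ltn_ord i) with end)) => i rho /=.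
by apply: congr1; apply: funext => -[].
Qed.
Lemma tdef_pg s n : tdef s -> tdef (fun i rho => pg (s i rho) n).
Proof. by move=> hs; elim: n => [|n IH] /=; [exact: tdef_eg|exact: tdef_mg hs IH]. Qed.
End GroupDefinability.

Ltac gfo_step := first
  [ exact: tdef_eg | apply: tdef_mg | apply: tdef_ig | apply: tdef_pg | fo_step
  | rewrite /cen /com /cjg ].
Ltac gfo := repeat gfo_step.

Section GroupDefinability2.
Variables (I : Type) (S : I -> structure Lgroup).
Implicit Types r s t u v : forall i, (nat -> S i) -> S i.

Lemma def_cen s t : tdef s -> tdef t -> def (fun i rho => cen (s i rho) (t i rho)).
Proof. by move=> ds dt; gfo. Qed.

Lemma def_Div r s t : tdef r -> tdef s -> tdef t ->
  def (fun i rho => Div (r i rho) (s i rho) (t i rho)).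
Proof.
by move=> dr ds dt; apply: (def_subst3 (P := fun i => @Div (S i)) dr ds dt); rewrite /Div; gfo.
Qed.

Lemma def_Sq u v s t : tdef u -> tdef v -> tdef s -> tdef t ->
  def (fun i rho => Sq (u i rho) (v i rho) (s i rho) (t i rho)).
Proof.
move=> du dv ds dt; apply: (def_subst5 (P := fun i a b c d _ => Sq a b c d) du dv ds dt dt).
by rewrite /Sq; repeat first [apply: def_cen | apply: def_Div | gfo_step].
Qed.

Lemma def_Mul u v r s t : tdef u -> tdef v -> tdef r -> tdef s -> tdef t ->
  def (fun i rho => Mul (u i rho) (v i rho) (r i rho) (s i rho) (t i rho)).
Proof.
move=> du dv dr ds dt; apply: (def_subst5 (P := fun i => @Mul (S i)) du dv dr ds dt).
by rewrite /Mul; repeat first [apply: def_cen | apply: def_Sq | gfo_step].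
Qed.

Lemma def_Pow u v s t : tdef u -> tdef v -> tdef s -> tdef t ->
  def (fun i rho => Pow (u i rho) (v i rho) (s i rho) (t i rho)).
Proof.
move=> du dv ds dt; apply: (def_subst5 (P := fun i a b c d _ => Pow a b c d) du dv ds dt dt).
by rewrite /Pow; repeat first [apply: def_cen | apply: def_Mul | gfo_step].
Qed.

Lemma def_BSrel k u v : tdef u -> tdef v -> def (fun i rho => BSrel k (u i rho) (v i rho)).
Proof. by move=> du dv; rewrite /BSrel; gfo. Qed.

Lemma def_BSgen k u v : tdef u -> tdef v -> def (fun i rho => BSgen k (u i rho) (v i rho)).
Proof.
move=> du dv; apply: (def_subst5 (P := fun i a b _ _ _ => BSgen k a b) du dv du du du).
by rewrite /BSgen; repeat first [apply: def_cen | apply: def_BSrel | apply: def_Pow | gfo_step].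
Qed.
End GroupDefinability2.

Ltac gdef := repeat first [apply: def_cen | apply: def_Div | apply: def_Mul | apply: def_Pow
  | apply: def_BSrel | apply: def_BSgen | gfo_step].

(** * Arithmetic of the ring Z[1/k] *)

(** The divisibilities give [s = n (n + 1)] up to sign, and the congruences hold because
    [s - 2 = (n - 1) (n + 2)] and [s - 6 = (n - 2) (n + 3)]. With the wrong sign, [n = 2] and
    [n = -3] still pass both congruences for [s - 2]; the one for [s - 6] excludes them. *)
Lemma pronic_characterization (n s : int) :
  [/\ (n %| s)%Z, (n + 1 %| s)%Z & forall t, (n %| t)%Z -> (n + 1 %| t)%Z -> (s %| t)%Z] /\
  [/\ (n - 1 %| s - 2)%Z, (n + 2 %| s - 2)%Z & (n - 2 %| s - 6)%Z] <-> s = n * (n + 1).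
Proof.
have cop : coprimez n (n + 1).
  by apply/coprimezP; exists (-1, 1) => /=; ring.
split=> [[[h1 h2 h3] [h4 h5 h6]]|->]; last first.
  split; first by split=> [||t t1 t2]; [exact: dvdz_mulr|exact: dvdz_mull|rewrite Gauss_dvdz // t1].
  split; apply/dvdzP; [exists (n + 2)|exists (n - 1)|exists (n + 3)]; ring.
have d1 : (s %| n * (n + 1))%Z by apply: h3; [exact: dvdz_mulr|exact: dvdz_mull].
have d2 : (n * (n + 1) %| s)%Z by rewrite Gauss_dvdz // h1.
have e : `|s|%N = `|(n * (n + 1))%R|%N.
  by apply/eqP; rewrite eqn_dvd -!dvdzE d1 d2.
have [//|sE] : s = n * (n + 1) \/ s = - (n * (n + 1)).
  by move: e; clear; move: (n * (n + 1)) => w; lia.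
(* With the wrong sign, [s - 2] is congruent to [-4] modulo [n - 1], which leaves finitely many [n]
   to inspect. *)
rewrite {s e h1 h2 h3 d1 d2}sE in h4 h5 h6 *; have d4 : (n - 1 %| 4)%Z.
  have -> : 4%Z = - (n + 2) * (n - 1) - (- (n * (n + 1)) - 2) by ring.
  by rewrite rpredB // dvdz_mull.
have {d4} : -3 <= n <= 5.
  by move: d4; rewrite dvdzE => /dvdn_leq; clear; lia.
move: h4 h5 h6 => /dvdzP[a aE] /dvdzP[b bE] /dvdzP[c cE] /andP[n1 n2].
have : (n == -3) || (n == -2) || (n == -1) || (n == 0) || (n == 1) || (n == 2) ||
  (n == 3) || (n == 4) || (n == 5) by clear -n1 n2; lia.
clear -aE bE cE.
by do ![case/orP]; move/eqP => nE; rewrite {n}nE in aE bE cE *; lia.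
Qed.

Section Localization.
Variables (k : nat) (hk : (1 < k)%N).
Local Notation kk := (k%:R : rat).
Definition Zk (x : rat) := exists (n i : int), x = n%:~R * kk ^ i.

Lemma kk_neq0 : kk != 0. Proof. by rewrite pnatr_eq0; lia. Qed.

Lemma kkD (i j : int) : kk ^ (i + j) = kk ^ i * kk ^ j.
Proof. by rewrite expfzDr ?kk_neq0. Qed.

Lemma kk_eq1 (i : int) : kk ^ i = 1 -> i = 0.
Proof.
move/eqP; rewrite pexprz_eq1 ?ler0n // => /orP[/eqP //|].
by rewrite pnatr_eq1 => /eqP k1; move: hk; rewrite k1.
Qed.

Lemma Zk_int (n : int) : Zk n%:~R. Proof. by exists n, 0; rewrite expr0z mulr1. Qed.
Lemma Zk_exp (i : int) : Zk (kk ^ i). Proof. by exists 1, i; rewrite mul1r. Qed.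
Lemma Zk1 : Zk 1. Proof. exact: (Zk_int 1). Qed.
Lemma Zk0 : Zk 0. Proof. exact: (Zk_int 0). Qed.

Lemma ZkM x y : Zk x -> Zk y -> Zk (x * y).
Proof.
move=> [n [i ->]] [m [j ->]]; exists (n * m), (i + j).
by rewrite kkD rmorphM /= mulrACA.
Qed.

Lemma Zk_denom x : Zk x -> exists (n : int) (i : nat), x * kk ^+ i = n%:~R.
Proof.
move=> [n [[i|i] ->]].
  by exists (n * k%:R ^+ i), 0%N; rewrite expr0 mulr1 rmorphM rmorphXn rmorph_nat.
by exists n, i.+1; rewrite -mulrA mulVf ?mulr1 // expf_neq0 ?kk_neq0.
Qed.

Lemma ZkD x y : Zk x -> Zk y -> Zk (x + y).
Proof.
move=> /Zk_denom[n [i xi]] /Zk_denom[m [j yj]].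
exists (n * k%:R ^+ j + m * k%:R ^+ i), (- (i + j)%:Z).
have i0 : kk ^+ i != 0 by rewrite expf_neq0 ?kk_neq0.
have j0 : kk ^+ j != 0 by rewrite expf_neq0 ?kk_neq0.
rewrite rmorphD !rmorphM !rmorphXn !rmorph_nat /= -xi -yj -exprnN exprD.
by field; rewrite i0 j0.
Qed.

Lemma ZkN x : Zk x -> Zk (- x).
Proof. by move=> [n [i ->]]; exists (- n), i; rewrite rmorphN mulNr. Qed.

(** Powers of [k] are invertible modulo [D], so clearing denominators does not affect divisibility
    by [D]. *)
Lemma Zk_dvd (N D : int) x : coprimez D k -> Zk x -> N%:~R = x * D%:~R :> rat -> (D %| N)%Z.
Proof.
move=> cop /Zk_denom[n [i xi]] e.
have {e} : (N * k%:R ^+ i)%:~R = (n * D)%:~R :> rat.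
  by rewrite !rmorphM rmorphXn rmorph_nat /= -xi e mulrAC.
move=> /intr_inj e; have : (D %| N * k%:R ^+ i)%Z by rewrite e dvdz_mull.
by rewrite natz Gauss_dvdzl ?coprimezXr.
Qed.

Lemma geometric_dvd (m q : int) : exists2 z, Zk z & kk ^ (q * m) - 1 = z * (kk ^ m - 1).
Proof.
elim/int_ind: q => [|q [z hz e]|q [z hz e]].
- by exists 0; [exact: Zk0|rewrite mul0r expr0z subrr mul0r].
- exists (kk ^ m * z + 1); first by apply: ZkD; [apply: ZkM => //; exact: Zk_exp|exact: Zk1].
  by rewrite -addn1 PoszD mulrDl mul1r kkD mulrDl mul1r -mulrA -e; ring.
- exists (kk ^ (- m) * z - kk ^ (- m)).
    by apply: ZkD; [apply: ZkM => //|apply: ZkN]; exact: Zk_exp.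
  have BA : kk ^ (- m) * kk ^ m = 1 by rewrite -kkD addNr expr0z.
  rewrite -addn1 PoszD opprD mulrDl mulN1r kkD -[kk ^ (- _ * m)](subrK 1) e.
  by rewrite -[X in _ - X = _]BA; ring.
Qed.

Lemma coprime_pred_exp (c : nat) : (0 < c)%N -> coprimez (k%:Z ^+ c - 1) k.
Proof.
move=> c0; apply/coprimezP; exists (-1, k%:Z ^+ c.-1) => /=.
by rewrite -exprSr prednK //; ring.
Qed.

Lemma Zk_pred_dvd (m n : int) :
  (exists2 z, Zk z & kk ^ n - 1 = z * (kk ^ m - 1)) <-> (m %| n)%Z.
Proof.
split; last by move=> /dvdzP[q ->]; exact: geometric_dvd.
(* [k^(-i) - 1] and [k^i - 1] differ by the unit [- k^(-i)], so exponents may be replaced by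
   absolute values. *)
have absE (i : int) : exists2 z, Zk z & exists2 z', Zk z' & 
    kk ^ i - 1 = z * (kk ^+ `|i|%N - 1) /\ kk ^+ `|i|%N - 1 = z' * (kk ^ i - 1).
  case: i => i; first by exists 1; [exact: Zk1|exists 1; [exact: Zk1|rewrite !mul1r -exprnP]].
  have K0 : kk ^+ i.+1 != 0 by rewrite expf_neq0 ?kk_neq0.
  exists (- (kk ^ (Negz i))); first by apply: ZkN; exact: Zk_exp.
  exists (- (kk ^ (Posz i.+1))); first by apply: ZkN; exact: Zk_exp.
  rewrite -[kk ^ Negz i]/((kk ^+ i.+1)^-1) -[kk ^ Posz i.+1]/(kk ^+ i.+1).
  by rewrite -[`|Negz i|%N]/(i.+1); split; field.
move=> [z hz e]; have [m0|m0] := eqVneq m 0.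
  have /kk_eq1 -> : kk ^ n = 1 by apply/eqP; rewrite -subr_eq0 e m0 expr0z subrr mulr0.
  exact: dvdz0.
have [w hw [_ _ [mE _]]] := absE m; have [_ _ [w' hw' [_ nE]]] := absE n.
set a := `|m|%N in mE; set b := `|n|%N in nE.
have a0 : (0 < a)%N by rewrite absz_gt0.
have : (k%:Z ^+ a - 1 %| k%:Z ^+ b - 1)%Z.
  apply: (@Zk_dvd _ _ (w' * z * w)); last 2 first.
  - by apply: ZkM => //; exact: ZkM.
  - by rewrite !rmorphB !rmorphXn /= -!pmulrn nE e mE !mulrA.
  exact: coprime_pred_exp.
have kx i : k%:Z ^+ i - 1 = (k ^ i).-1%:Z.
  have e1 : k%:Z ^+ i = (k ^ i)%N%:Z by rewrite -!natz natrX.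
  have := expn_gt0 k i; rewrite e1 (ltnW hk) /=; lia.
(* Modulo [k^a - 1] the number [k^b - 1] reduces to [k^r - 1], which is smaller than [k^a - 1] and
   therefore must vanish. *)
pose r := (b %% a)%N; pose q := (b %/ a)%N.
have bE : b = (a * q + r)%N by rewrite mulnC -divn_eq.
rewrite !kx !dvdzE /= -/a -/b bE expnD => h.
have ra : (r < a)%N by rewrite ltn_mod.
suff r0 : r = 0%N by rewrite r0 addn0 dvdn_mulr.
have {}h : ((k ^ a).-1 %| (k ^ r).-1)%N.
  have e1 : ((k ^ (a * q) * k ^ r).-1 = (k ^ (a * q)).-1 * k ^ r + (k ^ r).-1)%N.
    have k0 i : (0 < k ^ i)%N by rewrite expn_gt0 (ltnW hk).
    move: (k0 (a * q)%N) (k0 r); move: (k ^ (a * q))%N (k ^ r)%N => x y.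
    by case: x => // x _ y0; rewrite mulSn; lia.
  move: h; rewrite e1 dvdn_addr // dvdn_mulr // expnM.
  exact: dvdn_pred_predX.
have kra : (k ^ r < k ^ a)%N by rewrite ltn_exp2l.
have k0 : (0 < k ^ r)%N by rewrite expn_gt0 (ltnW hk).
have [//|r0] := posnP r; have : (1 < k ^ r)%N by rewrite -(exp1n r) ltn_exp2r.
by move=> k1; have := dvdn_leq _ h; lia.
Qed.

(** For large [c] the numerator would be a multiple of an integer exceeding its absolute value. This
    is what makes the congruences in [Pow] determine [w] completely. *)
Lemma Zk_separated x : Zk x ->
  (forall c : int, c != 0 -> exists2 z, Zk z & x = z * (kk ^ c - 1)) -> x = 0.
Proof.
move=> /Zk_denom[d [j xE]] H; have K0 : kk ^+ j != 0 by rewrite expf_neq0 ?kk_neq0.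
suff d0 : d = 0 by apply: (mulIf K0); rewrite xE d0 mul0r.
pose c := `|d|%N.+1; have [z hz zE] := H c isT.
have : (k%:Z ^+ c - 1 %| d)%Z.
  apply: (@Zk_dvd _ _ (z * kk ^ j)); first exact: coprime_pred_exp.
    by apply: ZkM => //; exact: Zk_exp.
  by rewrite -xE zE rmorphB rmorphXn /= -pmulrn mulrAC.
have := ltn_expl c hk => kc.
have -> : k%:Z ^+ c - 1 = (k ^ c).-1%:Z.
  have e1 : k%:Z ^+ c = (k ^ c)%N%:Z by rewrite -!natz natrX.
  by have := expn_gt0 k c; rewrite e1 (ltnW hk) /=; lia.
rewrite dvdzE /= => h; apply/eqP; rewrite -absz_eq0 -leqn0 leqNgt; apply/negP => d0.
by have := dvdn_leq d0 h; move: kc; rewrite /c; lia.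
Qed.

(* [(1 + y)^n = 1 + n y] modulo [y^2], for [y = k^c - 1] and negative [n] too. *)
Lemma Zk_binomial (c n : int) : exists2 z, Zk z &
  kk ^ (c * n) - 1 = n%:~R * (kk ^ c - 1) + z * (kk ^ c - 1) ^+ 2.
Proof.
elim/int_ind: n => [|n [z hz e]|n [z hz e]].
- by exists 0; [exact: Zk0|rewrite mulr0 expr0z subrr !mul0r addr0].
- exists (kk ^ c * z + n%:~R).
    by apply: ZkD; [apply: ZkM => //; exact: Zk_exp|exact: Zk_int].
  rewrite -addn1 PoszD mulrDr mulr1 kkD -[kk ^ (c * _)](subrK 1) e rmorphD /=; ring.
- exists (kk ^ (- c) * (z + (n%:~R + 1))).
    apply: ZkM; first exact: Zk_exp.
    by apply: ZkD => //; apply: ZkD; [exact: Zk_int|exact: Zk1].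
  rewrite -addn1 PoszD opprD mulrDr mulrN1 kkD -[kk ^ (c * _)](subrK 1) e.
  have -> : kk ^ (- c) = (kk ^ c)^-1 by rewrite invr_expz.
  rewrite rmorphB rmorphN /=; have := expfz_neq0 c kk_neq0.
  by move: (kk ^ c) => A A0; field.
Qed.
End Localization.

Lemma int_equiv : ring_elem_equiv int int. Proof. by []. Qed.

(* [g |-> (om g, pi g)] is an isomorphism onto [Z[1/k] x| Z]. *)
Record qmodel (k : nat) (G : group_str) (om : gcar G -> rat) (pi : gcar G -> int) : Prop := QModel {
  q_group : is_group G;
  q_om : forall g h, om (g * h)%gs = om g + om h * k%:R ^ (- pi g);
  q_pi : forall g h, pi (g * h)%gs = pi g + pi h;
  q_inj : forall g h, om g = om h -> pi g = pi h -> g = h;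
  q_Zk : forall g, Zk k (om g);
  q_surj : forall x m, Zk k x -> exists g, om g = x /\ pi g = m }.

Lemma frame_qmodel k (G : group_str) (al be : int -> gcar G) : (1 < k)%N ->
  frame k al be -> exists om pi, @qmodel k G om pi /\ forall n i m,
    om (theta al be n i m) = n%:~R * k%:R ^ (- i) /\ pi (theta al be n i m) = m.
Proof.
move=> hk F; have k0 := kk_neq0 hk; have kD := kkD hk.
have ex g : exists t : int * int * int, g = theta al be t.1.1 t.1.2 t.2.
  by have [n [i [m ->]]] := theta_surj F g; exists (n, i, m).
have [c hc] := choice ex.
pose om g : rat := (c g).1.1%:~R * k%:R ^ (- (c g).1.2); pose pi g : int := (c g).2.
(* Dividing the equation in [crit] by the common power [k^(i3 + d3)] turns it into an equation of
   rational numbers. *)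
have critE (n1 i1 m1 n2 i2 m2 n3 i3 m3 : int) :
    crit k (M := ring_struct int) n1 i1 m1 n2 i2 m2 n3 i3 m3 ->
    m3 = m1 + m2 /\ n3%:~R * k%:R ^ (- i3) =
      n1%:~R * k%:R ^ (- i1) + n2%:~R * k%:R ^ (- i2) * k%:R ^ (- m1) :> rat.
  move=> [-> [d1 [d2 [d3 [p1 [p2 [p3 [/ExpK_int[h1 e1] [/ExpK_int[h2 e2] [/ExpK_int[h3 e3]]]]]]]]]]].
  rewrite !ringE => -[f1 [f2 f3]]; split=> //.
  have pE (p d : int) : 0 <= d -> p = k%:R ^+ `|d|%N -> p%:~R = k%:R ^ d :> rat.
    by move=> d0 ->; rewrite rmorphXn rmorph_nat exprnP; congr (_ ^ _); lia.
  have := congr1 (fun x : int => x%:~R : rat) f3.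
  rewrite rmorphD !rmorphM /= (pE _ _ h1 e1) (pE _ _ h2 e2) (pE _ _ h3 e3) => f.
  have -> : - i3 = d3 - (i3 + d3) by ring.
  rewrite [k%:R ^ (d3 - _)]kD mulrA -f mulrDl -!mulrA -!kD.
  by congr (_ * _ ^ _ + _ * _ ^ _); lia.
have thE n i m : om (theta al be n i m) = n%:~R * k%:R ^ (- i) /\ pi (theta al be n i m) = m.
  have := hc (theta al be n i m) => /(theta_eq int_equiv F)/critE[e1 e2].
  by rewrite /om /pi e1 addr0 e2 mulr0z !mul0r addr0.
have hG := frame_group F.
have mulE g h : om (g * h)%gs = om g + om h * k%:R ^ (- pi g) /\ pi (g * h)%gs = pi g + pi h.
  have [n [i [m e]]] := theta_surj F (g * h)%gs.
  have := e; rewrite {1}(hc g) {1}(hc h) => /(theta_mul int_equiv F)/critE[e1 e2].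
  by rewrite e (thE n i m).1 (thE n i m).2.
exists om, pi; split=> //; split=> //.
- by move=> g h; case: (mulE g h).
- by move=> g h; case: (mulE g h).
- move=> g h; have [n [i [m ->]]] := theta_surj F g; have [n' [i' [m' ->]]] := theta_surj F h.
  have [-> ->] := thE n i m; have [-> ->] := thE n' i' m' => e1 e2.
  apply/(theta_eq int_equiv F); split; first by rewrite ringE addr0.
  have [d [e [f [p [q [r [[h1 h2 h3] [f1 f2]]]]]]]] := ExpK_directed k int_equiv i m i'.
  exists d, e, f, p, q, r; split=> //; split=> //; split=> //; rewrite !ringE addr0.
  split=> //; split; first by rewrite -f1.
  rewrite mul0r addr0; move: h1 h3 => /ExpK_int[d0 ->] /ExpK_int[ff ->].
  apply: (@intr_inj rat); rewrite !rmorphM !rmorphXn !rmorph_nat /=.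
  have dE (x : int) : 0 <= x -> (k%:R : rat) ^+ `|x|%N = k%:R ^ x.
    by move=> x0; rewrite exprnP; congr (_ ^ _); lia.
  rewrite !dE //; have -> : d = - i + (i + d) by ring.
  by rewrite f2 kD mulrA e1 -mulrA -kD; congr (_ * _ ^ _); lia.
- by move=> g; exists (c g).1.1, (- (c g).1.2).
- move=> x m [n [i ->]]; exists (theta al be n (- i) m); have [-> ->] := thE n (- i) m.
  by rewrite opprK.
Qed.

Section GroupStruct.
Variable G : group_str.
Implicit Types x y : gcar G.
Lemma mgE x y : mg (M := group_struct G) x y = (x * y)%gs. Proof. by []. Qed.
Lemma igE x : ig (M := group_struct G) x = (x^-1)%gs. Proof. by []. Qed.
Lemma egE : eg (group_struct G) = 1%gs. Proof. by []. Qed.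
Lemma pgE x n : pg (M := group_struct G) x n = gpow x n.
Proof. by elim: n => //= n ->. Qed.

Hypothesis hG : is_group G.
Lemma cenM x y v : cen (M := group_struct G) x v -> cen (M := group_struct G) y v ->
  cen (M := group_struct G) (x * y)%gs v.
Proof. by rewrite /cen !mgE => e1 e2; rewrite -gmulA // e2 !gmulA // e1. Qed.
Lemma cenV x v : cen (M := group_struct G) x v -> cen (M := group_struct G) (x^-1)%gs v.
Proof.
by rewrite /cen !mgE => e; apply: (gmulI hG (x := x)); rewrite gmulK // gmulA // e gmulrK.
Qed.
Lemma cen1 v : cen (M := group_struct G) 1%gs v.
Proof. by rewrite /cen !mgE gmul1 // gmulr1. Qed.
End GroupStruct.

(** * The group formulas evaluated in [Z[1/k] x| Z] *)

Section StandardModel.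
Variables (k : nat) (hk : (1 < k)%N) (G : group_str) (om : gcar G -> rat) (pi : gcar G -> int).
Hypothesis Q : qmodel k om pi.
Local Notation kk := (k%:R : rat).
Local Notation M := (group_struct G).
Implicit Types g h c m n s t w : gcar G.
Let hG := q_group Q.
Let omM := q_om Q.
Let piM := q_pi Q.

Lemma om1 : om 1%gs = 0 /\ pi 1%gs = 0.
Proof.
have p0 : pi 1%gs = 0.
  by have := piM 1%gs 1%gs; rewrite gmul1 // => /eqP; rewrite -subr_eq subrr => /eqP.
split=> //; have := omM 1%gs 1%gs; rewrite gmul1 // p0 oppr0 expr0z mulr1.
by move=> /eqP; rewrite -subr_eq subrr => /eqP.
Qed.

Lemma piV g : pi (g^-1)%gs = - pi g.
Proof. by apply/eqP; rewrite -addr_eq0 -piM gmulV // om1.2. Qed.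

Lemma omV g : om (g^-1)%gs = - om g * kk ^ (pi g).
Proof.
have := omM (g^-1)%gs g; rewrite gmulV // om1.1 piV opprK => /esym/eqP.
by rewrite addr_eq0 mulNr => /eqP.
Qed.

Lemma pi_pow g (n : nat) : pi (gpow g n) = pi g * n%:Z.
Proof. by elim: n => [|n IH] /=; rewrite ?om1.2 ?mulr0 // piM IH -add1n PoszD mulrDr mulr1. Qed.

Lemma om_pow g (n : nat) : pi g = 0 -> om (gpow g n) = om g * n%:R.
Proof.
move=> g0; elim: n => [|n IH] /=; first by rewrite om1.1 mulr0.
by rewrite omM IH g0 oppr0 expr0z mulr1 mulrSr addrC mulrDr mulr1.
Qed.

Lemma cjgE g c : pi g = 0 -> om (cjg (M := M) g c) = om g * kk ^ pi c /\ pi (cjg (M := M) g c) = 0.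
Proof.
move=> g0; rewrite /cjg !mgE igE; split; last by rewrite !piM piV g0; ring.
rewrite !omM omV !piM piV g0 addr0 opprK mulNr addrAC [- _ + _]addNr add0r //.
Qed.

Lemma comE g c : pi g = 0 -> om (com (M := M) g c) = om g * (kk ^ pi c - 1) /\ pi (com (M := M) g c) = 0.
Proof.
move=> g0; have [o p] := cjgE c g0; rewrite /com mgE igE; split; last by rewrite piM p piV g0 oppr0.
by rewrite omM p omV o g0 oppr0 !expr0z !mulr1 mulrBr mulr1.
Qed.

Variables (u v : gcar G).
Hypothesis uv : BSrel (M := M) k u v.

(** Projected to [Z], the relation reads [pi u = k pi u], so [pi u = 0] and [om u] is nonzero.
    Conjugation by [v] multiplies [om u] by [k^(pi v)], and this factor must be [k]. *)
Lemma BSrel_pi : [/\ pi u = 0, om u != 0 & pi v = 1].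
Proof.
have [+ u1] := uv; rewrite pgE /cjg !mgE igE => e.
have k0 : k%:Z - 1 != 0 by rewrite subr_eq0; apply/eqP => -[k1]; move: hk; rewrite k1.
have pu : pi u = 0.
  have /eqP := congr1 pi e; rewrite pi_pow !piM piV addrC addrA subrr add0r eq_sym -subr_eq0.
  by rewrite -[X in _ - X]mulr1 -mulrBr mulf_eq0 (negbTE k0) orbF => /eqP.
have ou : om u != 0.
  by apply/eqP => ou; apply: u1; apply: (q_inj Q); rewrite ?egE ?om1.1 ?om1.2.
split=> //; have := congr1 om e; rewrite om_pow //.
have := (cjgE v pu).1; rewrite /cjg !mgE igE => -> /(mulfI ou).
move=> e'; apply/eqP; rewrite -subr_eq0; apply/eqP/(kk_eq1 hk).
by rewrite (kkD hk) e' -{1}[kk]expr1z -(kkD hk) subrr expr0z.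
Qed.

Let pu : pi u = 0. Proof. by case: BSrel_pi. Qed.
Let ou : om u != 0. Proof. by case: BSrel_pi. Qed.
Let pv : pi v = 1. Proof. by case: BSrel_pi. Qed.

(** An element acts on the nonzero [om u] through a power of [k], and only the zeroth power fixes
    it. *)
Lemma cen_u w : cen (M := M) w u <-> pi w = 0.
Proof.
rewrite /cen !mgE; split=> [/(congr1 om)|w0].
  rewrite !omM pu oppr0 expr0z mulr1 addrC => /addIr/eqP.
  rewrite -[X in _ == X]mulr1 (inj_eq (mulfI ou)) => /eqP/(kk_eq1 hk)/eqP.
  by rewrite oppr_eq0 => /eqP.
apply: (q_inj Q); last by rewrite !piM addrC.
by rewrite !omM pu w0 oppr0 expr0z !mulr1 addrC.
Qed.

(** Commuting with [v] means [om g (1 - k^(-1)) = om v (1 - k^(- pi g))], so [pi g] determines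
    [om g]. *)
Lemma cen_v_inj g h : cen (M := M) g v -> cen (M := M) h v -> pi g = pi h -> g = h.
Proof.
rewrite /cen !mgE => /(congr1 om) + /(congr1 om) + e; rewrite !omM pv e => e1 e2.
apply: (q_inj Q) e.
have : (om g - om h) * (1 - kk ^ (-1)) = 0.
  transitivity ((om g + om v * kk ^ (- pi h) - (om v + om g * kk ^ (-1))) -
    (om h + om v * kk ^ (- pi h) - (om v + om h * kk ^ (-1)))); first ring.
  by rewrite e1 e2 !subrr.
move/eqP; rewrite mulf_eq0 !subr_eq0 => /orP[/eqP//|/eqP/esym/(kk_eq1 hk)]; lia.
Qed.

Lemma cen_v_surj (m : int) : exists2 g, cen (M := M) g v & pi g = m.
Proof.
elim/int_ind: m => [|m [g hg e]|m [g hg e]].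
- by exists 1%gs; [exact: (cen1 hG)|exact: om1.2].
- by exists (g * v)%gs; [exact: (cenM hG)|rewrite piM e pv -addn1 PoszD].
- exists (g * v^-1)%gs; first by apply: (cenM hG) => //; exact: (cenV hG).
  by rewrite piM piV e pv -addn1 PoszD opprD.
Qed.

Lemma DivE m n : Div (M := M) u m n <-> (pi m %| pi n)%Z.
Proof.
rewrite -(Zk_pred_dvd hk); split=> [H|[z hz zE] w /cen_u w0].
  (* One test element suffices: [om w = 1] turns solvability into divisibility by [k^(pi m) - 1]. *)
  have [w [w1 w0]] := q_surj Q 0 (Zk1 k).
  have [z [/cen_u z0 e]] := H w ((cen_u w).2 w0).
  exists (om z); first exact: q_Zk Q z.
  by rewrite -(comE m z0).1 -e (comE n w0).1 w1 mul1r.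
have [x [x1 x0]] := q_surj Q 0 (ZkM hk (q_Zk Q w) hz).
exists x; split; first exact/cen_u.
have [[o1 p1] [o2 p2]] := (comE n w0, comE m x0).
by apply: (q_inj Q); rewrite ?p1 ?p2 // o1 o2 zE x1 mulrA.
Qed.

Lemma SqE n s : Sq (M := M) u v n s <-> pi s = pi n * (pi n + 1).
Proof.
have piP g h (m : nat) : pi (g * gpow h m)%gs = pi g + pi h * m%:Z by rewrite piM pi_pow.
rewrite -pronic_characterization /Sq !pgE !DivE !mgE !igE !piP !piM !piV pv !mulN1r mul1r.
split=> [[h1 [h2 [h3 [h4 [h5 h6]]]]]|[[h1 h2 h3] [h4 h5 h6]]]; last first.
  by do 2! split=> //; split=> // t _ /DivE t1 /DivE; rewrite piM pv => t2; apply/DivE; exact: h3.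
do 2! split=> //; move=> t t1 t2; have [g hg gE] := cen_v_surj t.
by have := h3 g hg; rewrite !DivE ?mgE piM pv gE; apply.
Qed.

Lemma MulE x y z : cen (M := M) x v -> cen (M := M) y v -> cen (M := M) z v ->
  Mul (M := M) u v x y z <-> pi z = pi x * pi y.
Proof.
move=> hx hy hz; split.
  move=> [p [q [r [_ [_ [_ [/SqE h1 [/SqE h2 [/SqE h3 /(congr1 pi)]]]]]]]]].
  by rewrite h1 !mgE !piM h2 h3; lra.
move=> e; have [p hp pE] := cen_v_surj (pi (x * y)%gs * (pi (x * y)%gs + 1)).
have [q hq qE] := cen_v_surj (pi x * (pi x + 1)).
have [r hr rE] := cen_v_surj (pi y * (pi y + 1)).
exists p, q, r; do 3! split=> //; do 3! (split; first by apply/SqE).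
apply: cen_v_inj => //; first by rewrite !mgE; do !apply: (cenM hG).
by rewrite !mgE !piM pE qE rE e !piM; ring.
Qed.

(** By the binomial congruence, cancelling one factor [k^c - 1] shows that [om w - om u * n] is
    divisible by every [k^c - 1], so [Zk_separated] applies. Conversely, the error term of the same
    congruence provides [z]. *)
Lemma PowE n w : cen (M := M) n v ->
  Pow (M := M) u v n w <-> pi w = 0 /\ om w = om u * (pi n)%:~R.
Proof.
move=> hn; split=> [[/cen_u w0 H]|[w0 wE]].
  split=> //; apply/eqP; rewrite -subr_eq0; apply/eqP/(Zk_separated hk).
    apply: ZkD => //; first exact: q_Zk Q w.
    by apply: ZkN; apply: ZkM => //; [exact: q_Zk Q u|exact: Zk_int].
  move=> m m0; have [c hc cE] := cen_v_surj m.
  have [s hs sE] := cen_v_surj (m * pi n).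
  have c1 : c <> eg M by move=> c1; move: m0; rewrite -cE c1 egE om1.2.
  have cns : Mul (M := M) u v c n s by apply/MulE; rewrite // sE cE.
  have [z [/cen_u z0 /(congr1 om)]] := H c s hc c1 hs cns.
  have [z1 z2 ] := comE c z0; rewrite mgE omM (comE s pu).2 (comE c z2).1 z1 (comE s pu).1 (comE c w0).1.
  have [b hb bE] := Zk_binomial hk m (pi n).
  rewrite sE bE cE oppr0 expr0z mulr1 => e.
  have y0 : kk ^ m - 1 != 0.
    by rewrite subr_eq0; apply/eqP => /(kk_eq1 hk) m1; rewrite m1 eqxx in m0.
  exists (om u * b + om z).
    by apply: ZkD; [|apply: ZkM; [|exact: q_Zk Q u|]|exact: q_Zk Q z].
  apply: (mulIf y0); rewrite mulrBl e; ring.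
split; first exact/cen_u; move=> c s hc c1 hs /MulE sE.
have [b hb bE] := Zk_binomial hk (pi c) (pi n).
have [z [z1 z0]] := q_surj Q 0 (ZkN (ZkM hk (q_Zk Q u) hb)).
exists z; split; first exact/cen_u.
have [o1 p1] := comE c z0; have [o2 p2] := comE c p1; have [o3 p3] := comE s pu.
apply: (q_inj Q); last by rewrite mgE piM p2 p3 (comE c w0).2.
rewrite mgE omM p3 oppr0 expr0z mulr1 o2 o1 o3 sE // bE z1 (comE c w0).1 wE; ring.
Qed.
End StandardModel.

(** * The presented group *)

Section IntegerPowers.
Variables (G : group_str) (hG : is_group G).
Implicit Types x y : gcar G.

Definition zpow x (n : int) : gcar G :=
  match n with Posz n => gpow x n | Negz n => ((gpow x n.+1)^-1)%gs end.

Lemma gpowSr x n : gpow x n.+1 = (gpow x n * x)%gs.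
Proof. by elim: n => [|n IH]; rewrite /= ?gmul1 ?gmulr1 // -gmulA // -IH. Qed.

Lemma zpow_succ x n : zpow x (n + 1) = (zpow x n * x)%gs.
Proof.
case: n => [n|[|n]]; first by rewrite -PoszD addn1 [LHS]gpowSr.
  by rewrite /= gmulr1 // gmulV.
have -> : Negz n.+1 + 1 = Negz n by lia.
by rewrite /zpow -[gpow x n.+2]/(x * gpow x n.+1)%gs ginvM // gmulrKV.
Qed.

Lemma zpow1 x : zpow x 1 = x. Proof. exact: gmulr1. Qed.

Lemma zpow_pred x n : zpow x (n - 1) = (zpow x n * x^-1)%gs.
Proof. by rewrite -{2}(subrK 1 n) zpow_succ gmulrK. Qed.

Lemma zpowD x m n : zpow x (m + n) = (zpow x m * zpow x n)%gs.
Proof.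
elim/int_ind: n => [|n IH|n IH]; first by rewrite addr0 /= gmulr1.
  by rewrite -addn1 PoszD addrA !zpow_succ IH gmulA.
by rewrite -addn1 PoszD opprD addrA !zpow_pred IH gmulA.
Qed.

Lemma zpow0 x : zpow x 0 = 1%gs. Proof. by []. Qed.

Lemma zpowN x n : zpow x (- n) = ((zpow x n)^-1)%gs.
Proof. by apply: ginv_uniq => //; rewrite -zpowD subrr. Qed.
End IntegerPowers.

Section RationalModel.
Variables (k : nat) (hk : (1 < k)%N).
Local Notation kk := (k%:R : rat).

(** The target of the universal property in which [a^n] and [b^m] are seen to be independent; taking
    all of [rat] avoids cutting out [Z[1/k]]. *)
Definition QZ : group_str := @GroupStr (rat * int)%type
  (fun p q => (p.1 + q.1 * kk ^ (- p.2), p.2 + q.2))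
  (fun p => (- p.1 * kk ^ p.2, - p.2)) (0, 0).

Lemma QZ_group : is_group QZ.
Proof.
split=> [[x1 m1] [x2 m2] [x3 m3]|[x m]|[x m]] /=; congr (_, _).
- by rewrite opprD kkD //; ring.
- exact: addrA.
- by rewrite oppr0 expr0z mulr1 add0r.
- exact: add0r.
- by rewrite opprK mulNr addNr.
- exact: addNr.
Qed.

Lemma QZ_rel : gmul (gmul (ginv ((0, 1) : gcar QZ)) ((1, 0) : gcar QZ)) (0, 1) = gpow ((1, 0) : gcar QZ) k.
Proof.
have -> n : gpow ((1, 0) : gcar QZ) n = (n%:R, 0).
  by elim: n => //= n ->; rewrite expr0z mulr1 addr0 mulrS.
by rewrite /= oppr0 !mul0r add0r addr0 opprK expr1z mul1r.
Qed.
End RationalModel.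

Section Presentation.
Variables (k : nat) (hk : (1 < k)%N) (B : group_str) (a b : gcar B).
Hypothesis HB : is_BS_presentation k a b.
Let hB : is_group B. Proof. by case: HB. Qed.
Let al := zpow a.
Let be := zpow b.
Let alD (x y : int) : al (x + y) = (al x * al y)%gs. Proof. exact: zpowD. Qed.
Let beD (x y : int) : be (x + y) = (be x * be y)%gs. Proof. exact: zpowD. Qed.

Lemma conj_b n : (b^-1 * al n * b)%gs = al (n * k%:Z).
Proof.
have ab : (b^-1 * a * b)%gs = al k by case: HB.
have conjM x y : (b^-1 * (x * y) * b)%gs = (b^-1 * x * b * (b^-1 * y * b))%gs.
  by rewrite !gmulA // gmulrK.
have conjV : (b^-1 * a^-1 * b)%gs = (al k)^-1%gs.
  by apply: ginv_uniq => //; rewrite -ab -conjM gmulrV // gmulr1 // gmulV.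
elim/int_ind: n => [|n IH|n IH]; first by rewrite mul0r /al zpow0 gmulr1 // gmulV.
  by rewrite -addn1 PoszD /al zpow_succ // conjM IH ab -alD mulrDl mul1r.
by rewrite -addn1 PoszD opprD /al zpow_pred // conjM IH conjV -zpowN // -zpowD // mulrDl mulN1r.
Qed.

Lemma conj_be n (i : nat) : (be (- i%:Z) * al n * be i)%gs = al (n * k%:Z ^+ i).
Proof.
elim: i n => [|i IH] n; first by rewrite mulr1 oppr0 /be zpow0 gmul1 // gmulr1.
rewrite -addn1 PoszD opprD /be zpow_pred // zpow_succ //.
have -> : (zpow b (- i%:Z) * b^-1 * al n * (zpow b i * b) = 
  zpow b (- i%:Z) * (b^-1 * al n * b) * (zpow b i))%gs.
  have -> : (zpow b i * b = b * zpow b i)%gs.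
    by rewrite -zpow_succ // addrC zpowD // zpow1.
  by rewrite !gmulA.
by rewrite conj_b IH addn1 exprS mulrA.
Qed.

(** [i] is a natural number because [conj_be] makes [b^(-i) a^n b^i] a power of [a] for such [i]; a
    power of [a] on the left is then absorbed. *)
Let NF g := exists (n : int) (i : nat) (m : int), g = theta al be n i m.

Lemma NF_al (e : int) g : NF g -> NF (al e * g)%gs.
Proof.
move=> [n [i [m ->]]]; exists (e * k%:Z ^+ i + n), i, m.
by rewrite /theta alD -conj_be !gmulA // -beD subrr gmul1.
Qed.

Lemma NF_b g : NF g -> NF (b * g)%gs.
Proof.
move=> [n [i [m ->]]]; exists n, i.+1, (m + 1); rewrite /theta -addn1 PoszD opprD.
have -> : be (i%:Z + 1) = (b * be i)%gs by rewrite addrC beD /be zpow1.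
by rewrite -!gmulA // -!beD !gmulA //; congr (_ * _)%gs; congr be; lia.
Qed.

Lemma NF_bV g : NF g -> NF (b^-1 * g)%gs.
Proof.
move=> [n [[|i] [m ->]]].
  exists (n * k%:Z), 0%N, (m - 1).
  have b1 : be (m - 1) = (b^-1 * be m)%gs.
    by rewrite addrC beD /be zpowN // zpow1.
  by rewrite /theta b1 -conj_b oppr0 /be zpow0 !gmul1 // !gmulr1 // !gmulA // gmulrK.
exists n, i, (m - 1); rewrite /theta.
have -> : be i.+1 = (b * be i)%gs by rewrite -addn1 PoszD addrC beD /be zpow1.
rewrite !gmulA // gmulV // gmul1 // -!gmulA // -!beD.
by congr (_ * (_ * _))%gs; congr be; lia.
Qed.

Lemma normal_form g : NF g.
Proof.
(* Induction over generation also passes through inverses, so left multiplication by [x] and by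
   [x^-1] is treated together. *)
suff H x : forall y, NF y -> NF (x * y)%gs /\ NF (x^-1 * y)%gs.
  rewrite -[g](gmulr1 hB); apply: (H g _ _).1; exists 0, 0%N, 0.
  by rewrite /theta oppr0 /al /be !zpow0 !gmul1.
have [_ _ gen _] := HB; move: x; apply: gen.
- have a1 : al 1 = a by exact: zpow1.
  have aV : al (-1) = (a^-1)%gs by rewrite /al zpowN // zpow1.
  by move=> y hy; rewrite -aV -{1}a1; split; exact: NF_al.
- by move=> y hy; split; [exact: NF_b|exact: NF_bV].
- by move=> y hy; rewrite ginv1 // gmul1.
- move=> x y hx hy z hz; rewrite ginvM // -!gmulA //; split.
    exact: (hx _ (hy _ hz).1).1.
  exact: (hy _ (hx _ hz).2).2.
- by move=> x hx y hy; rewrite ginvK //; case: (hx y hy).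
Qed.

Lemma presentation_frame : frame k al be.
Proof.
split=> //.
- move=> p i n /ExpK_int[i0 ->]; have := conj_be n `|i|%N.
  have -> : `|i|%N%:Z = i by lia.
  by rewrite natz.
- by move=> g; have [n [i [m ->]]] := normal_form g; exists n, i%:Z, m.
have [_ _ _ univ] := HB.
have [f [fM fa fb]] := univ (QZ k) (1, 0) (0, 1) (QZ_group hk) (QZ_rel k).
have f1 := ghom1 hB (QZ_group hk) fM; have fV := ghomV hB (QZ_group hk) fM.
have fal n : f (al n) = (n%:~R, 0).
  elim/int_ind: n => [|n IH|n IH]; first exact: f1.
    rewrite -addn1 PoszD /al zpow_succ // fM IH fa /= oppr0 expr0z mulr1 addr0.
    by rewrite rmorphD.
  rewrite -addn1 PoszD opprD /al zpow_pred // fM IH fV fa /= oppr0 expr0z !mulr1 addr0.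
  by rewrite rmorphB.
have fbe n : f (be n) = (0, n).
  elim/int_ind: n => [|n IH|n IH]; first exact: f1.
    by rewrite -addn1 PoszD /be zpow_succ // fM IH fb /= mul0r addr0.
  by rewrite -addn1 PoszD opprD /be zpow_pred // fM IH fV fb /= oppr0 !mul0r addr0.
move=> n m /(congr1 f); rewrite fM fal fbe f1 /= mul0r addr0 add0r => -[/eqP].
by rewrite intr_eq0 => /eqP -> ->.
Qed.
End Presentation.

(** * Ring formulas in the group *)

(* Ring formulas interpreted, relationally, in the centralizer of [v] with the
   multiplication [Mul u v]. *)
Section RingInGroup.
Variables (M : structure Lgroup) (u v : M).

Fixpoint rterm (rho : nat -> M) (t : term Lring) (y : M) {struct t} : Prop :=
  match t with
  | Var n => rho n = y
  | App f a =>
    match f as f0 return ('I_(rarity f0) -> M -> Prop) -> Prop with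
    | RAdd => fun r => exists y1 y2, cen y1 v /\ cen y2 v /\ r ord0 y1 /\ r ord_max y2 /\ y = mg y1 y2
    | RMul => fun r => exists y1 y2, cen y1 v /\ cen y2 v /\ r ord0 y1 /\ r ord_max y2 /\ Mul u v y1 y2 y
    | RZero => fun _ => y = eg M
    | ROne => fun _ => y = v
    end (fun i => rterm rho (a i))
  end.

Fixpoint rsat (rho : nat -> M) (p : formula Lring) : Prop :=
  match p with
  | FBot => False
  | FEq s t => exists y, cen y v /\ rterm rho s y /\ rterm rho t y
  | FImp p q => rsat rho p -> rsat rho q
  | FAll n p => forall x, cen x v -> rsat (upd rho n x) p
  end.

Record ring_copy (N : structure Lring) (h : N -> M) : Prop := RingCopy {
  copy_cen : forall x, cen (h x) v;
  copy_surj : forall y, cen y v -> exists x, y = h x;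
  copy_inj : injective h;
  copyD : forall x y, h (radd x y) = mg (h x) (h y);
  copy0 : h (rzero N) = eg M;
  copy1 : h (rone N) = v;
  copyM : forall x y z, Mul u v (h x) (h y) (h z) <-> z = rmul x y }.

Lemma interp_add (N : structure Lring) a : @interp Lring N RAdd a = radd (a ord0) (a ord_max).
Proof.
apply: congr1; apply: funext => -[[|[|//]] hi] /=; congr (a _); exact: val_inj.
Qed.
Lemma interp_mul (N : structure Lring) a : @interp Lring N RMul a = rmul (a ord0) (a ord_max).
Proof.
apply: congr1; apply: funext => -[[|[|//]] hi] /=; congr (a _); exact: val_inj.
Qed.
Lemma interp_zero (N : structure Lring) a : @interp Lring N RZero a = rzero N.
Proof. by apply: congr1; apply: funext => -[]. Qed.
Lemma interp_one (N : structure Lring) a : @interp Lring N ROne a = rone N.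
Proof. by apply: congr1; apply: funext => -[]. Qed.

Lemma rterm_copy (N : structure Lring) (h : N -> M) : ring_copy h ->
  forall (rho : nat -> N) t y, cen y v ->
    rterm (fun n => h (rho n)) t y <-> y = h (eval rho t).
Proof.
move=> C rho; elim=> [n|f a IH] y hy /=; first by split=> ->.
have hc := copy_cen C.
case: f a IH => a IH /=.
- rewrite interp_add (copyD C); split=> [[y1 [y2 [c1 [c2 []]]]]|->].
    by move=> /(IH ord0 _ c1) -> [] /(IH ord_max _ c2) ->.
  exists (h (eval rho (a ord0))), (h (eval rho (a ord_max))).
  by do 2! split=> //; split; [exact/IH|split; [exact/IH|]].
- rewrite interp_mul; split=> [[y1 [y2 [c1 [c2 []]]]]|e].
    move=> /(IH ord0 _ c1) -> [] /(IH ord_max _ c2) ->.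
    by have [z ->] := copy_surj C hy => /(copyM C) ->.
  exists (h (eval rho (a ord0))), (h (eval rho (a ord_max))).
  do 2! split=> //; split; first exact/IH; split; first exact/IH.
  by rewrite e; apply/(copyM C).
- by rewrite interp_zero (copy0 C).
- by rewrite interp_one (copy1 C).
Qed.

Lemma rsat_copy (N : structure Lring) (h : N -> M) : ring_copy h ->
  forall p (rho : nat -> N), rsat (fun n => h (rho n)) p <-> sat rho p.
Proof.
move=> C; have hc := copy_cen C.
elim=> [|s t|p IHp q IHq|n p IH] rho //=.
- split=> [[y [hy [/(rterm_copy C rho _ hy) -> /(rterm_copy C rho _ (hc _))/(copy_inj C)]]] //|e].
  by exists (h (eval rho s)); do ! split=> //; apply/rterm_copy; rewrite // e.
- by rewrite IHp IHq.
- have E x : upd (fun m => h (rho m)) n (h x) = (fun m => h (upd rho n x m)).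
    by apply: funext => m; rewrite /upd; case: eqP.
  split=> [H x|H y /(copy_surj C)[x ->]]; first by apply/IH; rewrite -E; exact: H.
  by rewrite E; apply/IH.
Qed.
End RingInGroup.

Section RsatDefinability.
Variables (I : Type) (S : I -> structure Lgroup).

Lemma def_rterm t : def (S := S) (fun i rho => rterm (rho 1%N) (rho 2%N) (fun n => rho n.+3) t (rho 0%N)).
Proof.
elim: t => [n|f a IH] /=; first by gdef.
case: f a IH => a IH /=; last (by gdef); last by gdef.
- do 2! apply: def_ex; apply: def_and; first by gdef.
  apply: def_and; first by gdef.
  apply: def_and; first exact: (def_rename (fun j => if j is j'.+1 then j'.+3 else 1) (IH ord0)).
  apply: def_and; last by gdef.
  exact: (def_rename (fun j => if j is j'.+1 then j'.+3 else 0) (IH ord_max)).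
- do 2! apply: def_ex; apply: def_and; first by gdef.
  apply: def_and; first by gdef.
  apply: def_and; first exact: (def_rename (fun j => if j is j'.+1 then j'.+3 else 1) (IH ord0)).
  apply: def_and; last by gdef.
  exact: (def_rename (fun j => if j is j'.+1 then j'.+3 else 0) (IH ord_max)).
Qed.

Lemma def_rsat p : def (S := S) (fun i rho => rsat (rho 0%N) (rho 1%N) (fun n => rho n.+2) p).
Proof.
elim: p => [|s t|p IHp q IHq|n p IH] /=.
- exact: def_False.
- apply: def_ex; apply: def_and; first by gdef.
  by apply: def_and; exact: def_rterm.
- exact: def_imp.
- apply: (def_iff _ (def_allN n.+2 (def_imp (def_cen (tdef_var _ n.+2) (tdef_var _ 1)) IH))) => i rho /=.
  have e x : (fun m => upd rho n.+2 x m.+2) = upd (fun m => rho m.+2) n x by [].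
  by split=> H x; have := H x; rewrite /upd /= eqxx.
Qed.
End RsatDefinability.

Lemma group_iso_sat (G H : group_str) (f : gcar G -> gcar H) :
  is_group G -> is_group H -> bijective f -> group_hom f ->
  forall (P : forall M : structure Lgroup, (nat -> M) -> Prop) (rho : nat -> gcar G),
  def (S := fun M => M) P -> P (group_struct G) rho <-> P (group_struct H) (fun n => f (rho n)).
Proof.
move=> hG hH bf fM P rho [p hp]; rewrite -!hp.
apply: (@sat_iso _ (group_struct G) (group_struct H) f).
- by case: bf => g _ gK y; exists (g y); rewrite gK.
- exact: bij_inj.
- by case=> a /=; [exact: fM|exact: ghomV|exact: ghom1].
Qed.

Lemma BSrel_iso k (G H : group_str) (f : gcar G -> gcar H) (u v : gcar G) :
  is_group G -> is_group H -> bijective f -> group_hom f ->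
  BSrel (M := group_struct G) k u v -> BSrel (M := group_struct H) k (f u) (f v).
Proof.
move=> hG hH bf fM; have := group_iso_sat hG hH bf fM
  (P := fun M rho => BSrel k (rho 0%N) (rho 1%N)) (fun n => if n is 0%N then u else v).
by move=> /(_ ltac:(gdef))[].
Qed.

(** * The ring of exponents as an invariant of the group *)

Section Copies.
Variables (k : nat) (hk : (1 < k)%N).

Lemma qmodel_copy (G : group_str) om pi (u v : gcar G) : qmodel k om pi ->
  BSrel (M := group_struct G) k u v -> exists h : int -> gcar G,
    ring_copy (M := group_struct G) u v (N := ring_struct int) h /\ forall m, pi (h m) = m.
Proof.
move=> Q uv; have hG := q_group Q; have [_ _ pv] := BSrel_pi hk Q uv.
have ex m : exists g : gcar G, cen (M := group_struct G) g v /\ pi g = m.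
  by have [g] := cen_v_surj hk Q uv m; exists g.
have [h hP] := choice ex.
have hc m : cen (M := group_struct G) (h m) v by case: (hP m).
have hE m : pi (h m) = m by case: (hP m).
have inj g g' := @cen_v_inj _ hk _ _ _ Q _ _ uv g g'.
exists h; split=> //; split=> //.
- by move=> y hy; exists (pi y); apply: inj; rewrite ?hE.
- by move=> x y /(congr1 pi); rewrite !hE.
- move=> x y; apply: inj; rewrite ?hE //; first exact: (cenM hG (hc x) (hc y)).
  by rewrite mgE (q_pi Q) !hE.
- by apply: inj; rewrite ?hE ?(om1 Q).2 //; exact: (cen1 hG).
- by apply: inj; rewrite ?hE.
- by move=> x y z; rewrite (MulE hk Q uv) // !hE.
Qed.

Definition int_framed : framed k := Framed int_equiv (BSk_frame hk int_equiv).

Let S (F : framed k) := ring_struct (fring F).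

(** The product of [R] is compared with the group formula [Mul], so the statement is put in ring
    variables and transferred along the ring. The clauses say that on the centralizer of [v] the
    third coordinate is onto ([rho 6] being an arbitrary value), injective, one at [v], and carries
    [Mul] to the product. *)
Let centralizer_ring (F : framed k) (rho : nat -> S F) :=
  let u := fth (F := F) (rho 0%N) (rho 1%N) (rho 2%N) in
  let v := fth (F := F) (rho 3%N) (rho 4%N) (rho 5%N) in
  let x := fth (F := F) (rho 6%N) (rho 7%N) (rho 8%N) in
  let y := fth (F := F) (rho 9%N) (rho 10%N) (rho 11%N) in
  let z := fth (F := F) (rho 12%N) (rho 13%N) (rho 14%N) in
  let C g := cen (M := group_struct (fgroup F)) g v in
  BSrel (M := group_struct (fgroup F)) k u v ->
  (exists n i, C (fth n i (rho 6%N))) /\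
  (C x /\ C (fth (rho 9%N) (rho 10%N) (rho 8%N)) -> x = fth (rho 9%N) (rho 10%N) (rho 8%N)) /\
  rho 5%N = rone (S F) /\
  (C x /\ C y /\ C z ->
    (Mul (M := group_struct (fgroup F)) u v x y z <-> rho 14%N = rmul (rho 8%N) (rho 11%N))).

Lemma def_centralizer_ring : def (S := S) centralizer_ring.
Proof.
apply: def_imp.
  by apply: (def_framed k (P := fun M rho => BSrel k (rho 0%N) (rho 1%N))); gdef.
apply: def_and.
  do 2! apply: def_ex.
  (* Under the two existentials slots 0 and 1 hold [i] and [n], and earlier indices are raised by 2:
     the list reads [(n, i, rho 6)], then [v]. *)
  apply: (def_rename (fun j => nth 0%N [:: 1; 0; 8; 5; 6; 7]%N j)
    (def_framed k (P := fun M rho => cen (rho 0%N) (rho 1%N)) _)); gdef.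
apply: def_and.
  (* Sending slot 11 to 8 gives the two compared elements the same third coordinate. *)
  apply: (def_rename (fun j => if j == 11 then 8 else j)%N
    (def_framed k (P := fun M rho => cen (rho 2%N) (rho 1%N) /\ cen (rho 3%N) (rho 1%N) -> rho 2%N = rho 3%N) _)).
  by gdef.
apply: def_and; first by rfo.
apply: def_imp.
  by apply: (def_framed k (P := fun M rho =>
     cen (rho 2%N) (rho 1%N) /\ cen (rho 3%N) (rho 1%N) /\ cen (rho 4%N) (rho 1%N))); gdef.
apply: def_equiv; last by rfo.
by apply: (def_framed k (P := fun M rho => Mul (rho 0%N) (rho 1%N) (rho 2%N) (rho 3%N) (rho 4%N))); gdef.
Qed.

Lemma centralizer_ring_int (rho : nat -> S int_framed) : centralizer_ring rho.
Proof.
have [om [pi [Q thE]]] := frame_qmodel hk (framedP int_framed).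
move=> uv; have [_ _ pv] := BSrel_pi hk Q uv.
split.
  have [g hg gE] := cen_v_surj hk Q uv (rho 6%N).
  have [n [i [m e]]] := fth_surj (F := int_framed) g.
  by exists n, i; rewrite -gE e (thE n i m).2 -e.
split; first by move=> [h1 h2]; apply: (cen_v_inj hk Q uv h1 h2); rewrite !(thE _ _ _).2.
split; first by have := pv; rewrite (thE _ _ _).2.
by move=> [h1 [h2 h3]]; rewrite (MulE hk Q uv h1 h2 h3) !(thE _ _ _).2.
Qed.

(** Stated for arbitrary [u] and [v], since an isomorphism sends the standard generators to elements
    about which only [BSrel] is known. [h m] is the element of the centralizer with third coordinate
    [m]. *)
Lemma framed_copy (F : framed k) (u v : gcar (fgroup F)) :
  BSrel (M := group_struct (fgroup F)) k u v ->
  exists h, ring_copy (M := group_struct (fgroup F)) u v (N := ring_struct (fring F)) h.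
Proof.
move=> uv; have hF := framedP F; have hG := frame_group hF.
have H rho : centralizer_ring (F := F) rho.
  apply: (def_transfer (i := int_framed) def_centralizer_ring _ centralizer_ring_int) => p sp.
  exact: iff_sym (fringP F sp).
have [u1 [u2 [u3 uE]]] := fth_surj u; have [v1 [v2 [v3 vE]]] := fth_surj v.
subst u v; set v := fth v1 v2 v3 in uv *; set u := fth u1 u2 u3 in uv *.
have K x1 x2 x3 y1 y2 y3 z1 z2 z3 := H (nth 0 [:: u1; u2; u3; v1; v2; v3; x1; x2; x3; y1; y2; y3; z1; z2; z3]) uv.
have ex (m : fring F) : exists g : gcar (fgroup F),
    cen (M := group_struct (fgroup F)) g v /\ exists n i, g = fth n i m.
  have [[n [i hni]] _] := K m 0 0 0 0 0 0 0 0.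
  by exists (fth n i m); split=> //; exists n, i.
have [h hP] := choice ex.
have hc m : cen (M := group_struct (fgroup F)) (h m) v by case: (hP m).
have hu n i m : cen (M := group_struct (fgroup F)) (fth n i m) v -> fth n i m = h m.
  have [c [n' [i' e]]] := hP m; rewrite e in c *.
  by have [_ [inj _]] := K n i m n' i' 0 0 0 0 => c'; apply: inj.
have mulE n1 i1 m1 n2 i2 m2 n3 i3 m3 :
    (fth (F := F) n1 i1 m1 * fth n2 i2 m2)%gs = fth n3 i3 m3 -> m3 = m1 + m2.
  by move/(theta_mul (fringP F) hF) => [].
have v1E : h 1 = v.
  by apply/esym; have [_ [_ [e _]]] := K 0 0 0 0 0 0 0 0 0; rewrite /v [v3]e; apply: hu; rewrite -[rone _]e.
have hD x y : h (x + y) = (h x * h y)%gs.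
  have [c1 [n1 [i1 e1]]] := hP x; have [c2 [n2 [i2 e2]]] := hP y.
  have [n3 [i3 [m3 e3]]] := fth_surj (h x * h y)%gs.
  have m3E : m3 = x + y by apply: (mulE n1 i1 x n2 i2 y n3 i3); rewrite -e1 -e2.
  by rewrite e3 m3E; apply/esym/hu; rewrite -m3E -e3; apply: (cenM hG).
exists h; split=> //.
- move=> y; have [n [i [m ->]]] := fth_surj y => /hu ->; by exists m.
- move=> x y; have [_ [n1 [i1 ->]]] := hP x; have [_ [n2 [i2 ->]]] := hP y.
  by move=> e; have := mulE n1 i1 x 0 0 0 n2 i2 y; rewrite addr0 => -> //; rewrite -e /fth (theta_one hF) gmulr1.
- apply: (gmulI hG (x := h 0)); rewrite -[LHS]hD -[0 + _]/(0 + 0) addr0.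
  by rewrite egE gmulr1.
- move=> x y z; have [c1 [n1 [i1 e1]]] := hP x; have [c2 [n2 [i2 e2]]] := hP y.
  have [c3 [n3 [i3 e3]]] := hP z; rewrite e1 e2 e3 in c1 c2 c3 *.
  by have [_ [_ [_ e]]] := K n1 i1 x n2 i2 y n3 i3 z; apply: e.
Qed.

Lemma frame_BSrel (R : idomainType) (G : group_str) (al be : R -> gcar G) :
  ring_elem_equiv R int -> frame k al be -> BSrel (M := group_struct G) k (al 1) (be 1).
Proof.
move=> hR F; have hG := frame_group F; split; last first.
  rewrite egE => e; have [/eqP + _] : (1 : R) = 0 /\ (0 : R) = 0.
    by apply: (frame_free F); rewrite e (frame_be0 F) gmul1.
  by rewrite oner_eq0.
have powE n : gpow (al 1) n = al n%:R.
  by elim: n => [|n IH] /=; rewrite ?(frame_al0 F) // IH -(frame_al F) mulrS.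
rewrite pgE powE /cjg !mgE igE -(frame_beN F) (frame_conj F 1 (ExpK1 k hR)) mul1r //.
Qed.

Lemma copies_ring_iso (G H : group_str) (f : gcar G -> gcar H) (u v : gcar G)
  (R1 R2 : idomainType) (h1 : R1 -> gcar G) (h2 : R2 -> gcar H) :
  is_group G -> is_group H -> bijective f -> group_hom f ->
  ring_copy (M := group_struct G) u v (N := ring_struct R1) h1 ->
  ring_copy (M := group_struct H) (f u) (f v) (N := ring_struct R2) h2 -> ring_iso R1 R2.
Proof.
move=> hG hH bf fM C1 C2.
have fcen x : cen (M := group_struct G) x v <-> cen (M := group_struct H) (f x) (f v).
  have := group_iso_sat hG hH bf fM (P := fun M rho => cen (rho 0%N) (rho 1%N)) (fun n => if n is 0%N then x else v).
  by apply; gdef.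
have fMul x y z : Mul (M := group_struct G) u v x y z <-> Mul (M := group_struct H) (f u) (f v) (f x) (f y) (f z).
  have := group_iso_sat hG hH bf fM (P := fun M rho => Mul (rho 0%N) (rho 1%N) (rho 2%N) (rho 3%N) (rho 4%N)) (nth z [:: u; v; x; y]).
  by apply; gdef.
have ex (x : R1) : exists y : R2, f (h1 x) = h2 y.
  by apply: (copy_surj C2); apply/fcen; exact: (copy_cen C1).
have [phi phiE] := choice ex.
have i2 := copy_inj C2; have fi := bij_inj bf.
have ex' (y : R2) : exists x : R1, f (h1 x) = h2 y.
  case: bf => g _ gK; have [|x e] := copy_surj C1 (y := g (h2 y)).
    by apply/fcen; rewrite gK; exact: (copy_cen C2).
  by exists x; rewrite -e gK.
have [psi psiE] := choice ex'.
exists phi; split.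
- exists psi => x; last by apply: i2; rewrite -phiE psiE.
  by apply: (copy_inj C1); apply: fi; rewrite psiE phiE.
- by move=> x y; apply: i2; rewrite -phiE [RHS](copyD C2) -raddE (copyD C1) [LHS]fM !phiE.
- move=> x y; have /(copyM C1) : x * y = rmul (M := ring_struct R1) x y by [].
  by move=> /fMul; rewrite !phiE => /(copyM C2).
- by apply: i2; rewrite -phiE [RHS](copy1 C2) [h1 1](copy1 C1).
Qed.
End Copies.

(** * Integral domains from models *)

(** The argument [e] is a phantom: it ties to the type the hypothesis from which the axioms of its
    algebraic instances are derived. *)
Definition model_car (M : structure Lring) (e : elem_equiv M (ring_struct int)) : Type := sdom M.

Section Model.
Variables (M : structure Lring) (e : elem_equiv M (ring_struct int)).
Local Notation T := (model_car e).

Lemma model_transfer (P : forall M : structure Lring, (nat -> M) -> Prop) :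
  def (S := fun M => M) P -> (forall rho, P (ring_struct int) rho) -> forall rho, P M rho.
Proof.
move=> dP h; apply: (def_transfer (i := ring_struct int) dP) => // p sp.
exact: iff_sym (e sp).
Qed.

HB.instance Definition _ := gen_eqMixin T.
HB.instance Definition _ := gen_choiceMixin T.

Let add (x y : T) : T := radd (M := M) x y.
Let mul (x y : T) : T := rmul (M := M) x y.
Let zero : T := rzero M.
Let one : T := rone M.
Let env (x y z : M) := nth x [:: x; y; z].

Fact model_addA : associative add.
Proof.
move=> x y z; apply: (@model_transfer (fun M rho => radd (rho 0%N) (radd (rho 1%N) (rho 2%N)) =
  radd (radd (rho 0%N) (rho 1%N)) (rho 2%N)) _ _ (env x y z)); first by rfo.
by move=> rho; rewrite !ringE addrA.
Qed.
Fact model_addC : commutative add.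
Proof.
move=> x y; apply: (@model_transfer (fun M rho => radd (rho 0%N) (rho 1%N) =
  radd (rho 1%N) (rho 0%N)) _ _ (env x y x)); first by rfo.
by move=> rho; rewrite !ringE addrC.
Qed.
Fact model_add0 : left_id zero add.
Proof.
move=> x; apply: (@model_transfer (fun M rho => radd (rzero M) (rho 0%N) = rho 0%N) _ _ (env x x x)); first by rfo.
by move=> rho; rewrite !ringE add0r.
Qed.
(** The ring language has no negation: the existence of opposites transfers, and choice makes an
    operation of it. *)
Fact model_opp : exists opp : T -> T, left_inverse zero opp add.
Proof.
suff /choice[opp hopp] : forall x : T, exists y : T, add y x = zero by exists opp.
move=> x; apply: (@model_transfer (fun M rho => exists y, radd y (rho 0%N) = rzero M) _ _ (env x x x)); first by rfo.
by move=> rho; exists (- (rho 0%N : int)); rewrite !ringE addNr.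
Qed.
Let opp := projT1 (cid model_opp).
HB.instance Definition _ := GRing.isZmodule.Build T model_addA model_addC model_add0 (projT2 (cid model_opp)).

Fact model_mulA : associative mul.
Proof.
move=> x y z; apply: (@model_transfer (fun M rho => rmul (rho 0%N) (rmul (rho 1%N) (rho 2%N)) =
  rmul (rmul (rho 0%N) (rho 1%N)) (rho 2%N)) _ _ (env x y z)); first by rfo.
by move=> rho; rewrite !ringE mulrA.
Qed.
Fact model_mulC : commutative mul.
Proof.
move=> x y; apply: (@model_transfer (fun M rho => rmul (rho 0%N) (rho 1%N) =
  rmul (rho 1%N) (rho 0%N)) _ _ (env x y x)); first by rfo.
by move=> rho; rewrite !ringE mulrC.
Qed.
Fact model_mul1 : left_id one mul.
Proof.
move=> x; apply: (@model_transfer (fun M rho => rmul (rone M) (rho 0%N) = rho 0%N) _ _ (env x x x)); first by rfo.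
by move=> rho; rewrite !ringE mul1r.
Qed.
Fact model_mulDl : left_distributive mul add.
Proof.
move=> x y z; apply: (@model_transfer (fun M rho => rmul (radd (rho 0%N) (rho 1%N)) (rho 2%N) =
  radd (rmul (rho 0%N) (rho 2%N)) (rmul (rho 1%N) (rho 2%N))) _ _ (env x y z)); first by rfo.
by move=> rho; rewrite !ringE mulrDl.
Qed.
Fact model_1_neq0 : one != zero.
Proof.
apply/eqP; apply: (@model_transfer (fun M rho => rone M <> rzero M) _ _ (fun=> one)); first by rfo.
by [].
Qed.
HB.instance Definition _ := GRing.Zmodule_isComNzRing.Build T
  model_mulA model_mulC model_mul1 model_mulDl model_1_neq0.

Let unit : pred T := fun x => `[< exists y : T, y * x = 1 >].
Fact model_inv : exists inv : T -> T,
  {in unit, left_inverse 1 inv *%R} /\ {in [predC unit], inv =1 id}.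
Proof.
have /choice[inv hinv] : forall x : T, exists y : T, (unit x -> y * x = 1) /\ (~~ unit x -> y = x).
  move=> x; have [/asboolP[y yx]|nx] := boolP (unit x); first by exists y; split.
  by exists x; split.
by exists inv; split=> x hx; case: (hinv x) => h1 h2; [exact: h1|exact: h2].
Qed.
Fact model_unitP (x y : T) : y * x = 1 -> unit x.
Proof. by move=> h; apply/asboolP; exists y. Qed.
HB.instance Definition _ := GRing.ComNzRing_hasMulInverse.Build T
  (projT2 (cid model_inv)).1 model_unitP (projT2 (cid model_inv)).2.

Fact model_integral (x y : T) : x * y = 0 -> (x == 0) || (y == 0).
Proof.
move=> xy; suff [->|->] : x = 0 \/ y = 0 by rewrite eqxx ?orbT.
move: xy; apply: (@model_transfer (fun M rho => rmul (rho 0%N) (rho 1%N) = rzero M ->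
  rho 0%N = rzero M \/ rho 1%N = rzero M) _ _ (env x y x)); first by rfo.
move=> rho; rewrite !ringE => /eqP; rewrite mulf_eq0 => /orP[]/eqP; by [left|right].
Qed.
HB.instance Definition _ := GRing.ComUnitRing_isIntegral.Build T model_integral.

Lemma model_idomain : exists R : idomainType, ring_elem_equiv R int /\
  exists h : R -> M, [/\ bijective h, forall x y, h (x + y) = radd (h x) (h y),
    forall x y, h (x * y) = rmul (h x) (h y), h 0 = rzero M & h 1 = rone M].
Proof.
exists T; split; last by exists id; split=> //; exists id.
move=> p sp; rewrite -(e sp).
have E (rho : nat -> T) : sat (M := ring_struct T) rho p <-> sat (M := M) rho p.
  apply: (@sat_iso _ (ring_struct T) M id) => // [y|]; first by exists y.
  by case=> a; rewrite ?interp_add ?interp_mul ?interp_zero ?interp_one.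
by split=> h rho; apply/E/h.
Qed.
End Model.

(** * Groups elementarily equivalent to BS(1,k) *)

Section ElementaryEquivalents.
Variables (k : nat) (hk : (1 < k)%N).
Variables (B : group_str) (al be : int -> gcar B) (FB : frame k al be).
Variables (G : group_str) (hG : is_group G) (GB : group_elem_equiv G B).
Local Notation M := (group_struct G).

Lemma group_transfer (P : forall M : structure Lgroup, (nat -> M) -> Prop) :
  def (S := fun M => M) P -> (forall rho, P (group_struct B) rho) ->
  forall rho, P M rho.
Proof.
move=> dP h; apply: (def_transfer (i := group_struct B) dP) => // p sp.
exact: iff_sym (GB sp).
Qed.

(** The existence of parameters is a sentence. It holds in [B] for the standard generators, because
    conjugation by a power of [b] brings [n k^i] to the integer [n]. *)
Lemma ex_BSgen : exists u v : gcar G, BSgen (M := M) k u v.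
Proof.
apply: (@group_transfer (fun M rho => exists u v : M, BSgen k u v) _ _ (fun=> 1%gs)); first by gdef.
move=> _; have [om [pi [Q thE]]] := frame_qmodel hk FB.
have uv := frame_BSrel int_equiv FB; exists (al 1), (be 1); split=> // w /(cen_u hk Q uv) w0.
have [n [i wE]] := q_Zk Q w; have u1 : om (al 1) = 1.
  have := (thE 1 0 0).1; rewrite /theta oppr0 !(frame_be0 FB) expr0z mulr1.
  by rewrite gmul1 ?gmulr1 //; exact: frame_group FB.
have [c hc cE] := cen_v_surj hk Q uv (- i); have [d hd dE] := cen_v_surj hk Q uv n.
exists c, d; do 2! split=> //; apply/(PowE hk Q uv _ hd).
have [o p] := cjgE Q c w0; split=> //.
by rewrite o u1 wE cE dE mul1r -mulrA -kkD // subrr expr0z mulr1.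
Qed.

Variables (u v : gcar G) (uv : BSgen (M := M) k u v).
Local Notation C x := (cen (M := M) x v).
Local Notation "'Mul_uv'" := (Mul (M := M) u v).
Local Notation "'Pow_uv'" := (Pow (M := M) u v).
Let env (x y z w t : gcar G) := nth t [:: u; v; x; y; z; w].

Lemma Mul_total x y : C x -> C y -> exists z, C z /\ Mul_uv x y z.
Proof.
move: uv; apply: (@group_transfer (fun M rho => BSgen k (rho 0%N) (rho 1%N) ->
  cen (rho 2%N) (rho 1%N) -> cen (rho 3%N) (rho 1%N) ->
  exists z, cen z (rho 1%N) /\ Mul (rho 0%N) (rho 1%N) (rho 2%N) (rho 3%N) z) _ _ (env x y x x x)); first by gdef.
have [om [pi [Q _]]] := frame_qmodel hk FB.
move=> rho [bs _] hx hy; have [z hz zE] := cen_v_surj hk Q bs (pi (rho 2%N) * pi (rho 3%N)).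
by exists z; split=> //; apply/(MulE hk Q bs).
Qed.

Lemma Mul_fun x y z w : C x -> C y -> C z -> C w -> Mul_uv x y z -> Mul_uv x y w -> z = w.
Proof.
move: uv; apply: (@group_transfer (fun M rho => BSgen k (rho 0%N) (rho 1%N) ->
  cen (rho 2%N) (rho 1%N) -> cen (rho 3%N) (rho 1%N) -> cen (rho 4%N) (rho 1%N) ->
  cen (rho 5%N) (rho 1%N) -> Mul (rho 0%N) (rho 1%N) (rho 2%N) (rho 3%N) (rho 4%N) ->
  Mul (rho 0%N) (rho 1%N) (rho 2%N) (rho 3%N) (rho 5%N) -> rho 4%N = rho 5%N) _ _ (env x y z w x)); first by gdef.
have [om [pi [Q _]]] := frame_qmodel hk FB.
move=> rho [bs _] hx hy hz hw /(MulE hk Q bs hx hy hz) e1 /(MulE hk Q bs hx hy hw) e2.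
by apply: (cen_v_inj hk Q bs) => //; rewrite e1 e2.
Qed.

Lemma Pow_total n : C n -> exists w, Pow_uv n w.
Proof.
move: uv; apply: (@group_transfer (fun M rho => BSgen k (rho 0%N) (rho 1%N) ->
  cen (rho 2%N) (rho 1%N) -> exists w, Pow (rho 0%N) (rho 1%N) (rho 2%N) w) _ _ (env n n n n n)); first by gdef.
have [om [pi [Q _]]] := frame_qmodel hk FB.
move=> rho [bs _] hn; have [w [w1 w2]] := q_surj Q 0 (ZkM hk (q_Zk Q (rho 0%N)) (Zk_int k (pi (rho 2%N)))).
by exists w; apply/(PowE hk Q bs _ hn).
Qed.

Lemma Pow_fun n w x : C n -> Pow_uv n w -> Pow_uv n x -> w = x.
Proof.
move: uv; apply: (@group_transfer (fun M rho => BSgen k (rho 0%N) (rho 1%N) ->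
  cen (rho 2%N) (rho 1%N) -> Pow (rho 0%N) (rho 1%N) (rho 2%N) (rho 3%N) ->
  Pow (rho 0%N) (rho 1%N) (rho 2%N) (rho 4%N) -> rho 3%N = rho 4%N) _ _ (env n w x n n)); first by gdef.
have [om [pi [Q _]]] := frame_qmodel hk FB.
move=> rho [bs _] hn /(PowE hk Q bs _ hn)[p1 o1] /(PowE hk Q bs _ hn)[p2 o2].
by apply: (q_inj Q); rewrite ?p1 ?p2 ?o1 ?o2.
Qed.

Lemma PowM n m w x : C n -> C m -> Pow_uv n w -> Pow_uv m x -> Pow_uv (n * m)%gs (w * x)%gs.
Proof.
move: uv; apply: (@group_transfer (fun M rho => BSgen k (rho 0%N) (rho 1%N) ->
  cen (rho 2%N) (rho 1%N) -> cen (rho 3%N) (rho 1%N) ->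
  Pow (rho 0%N) (rho 1%N) (rho 2%N) (rho 4%N) -> Pow (rho 0%N) (rho 1%N) (rho 3%N) (rho 5%N) ->
  Pow (rho 0%N) (rho 1%N) (mg (rho 2%N) (rho 3%N)) (mg (rho 4%N) (rho 5%N))) _ _ (env n m w x n)); first by gdef.
have [om [pi [Q _]]] := frame_qmodel hk FB.
move=> rho [bs _] hn hm /(PowE hk Q bs _ hn)[p1 o1] /(PowE hk Q bs _ hm)[p2 o2].
apply/(PowE hk Q bs); first exact: (cenM (frame_group FB) hn hm).
rewrite !mgE (q_om Q) !(q_pi Q) p1 p2 o1 o2; split; first by rewrite addr0.
by rewrite oppr0 expr0z mulr1 rmorphD mulrDr.
Qed.

Lemma Pow_free n m w : C n -> C m -> Pow_uv n w -> (w * m)%gs = 1%gs -> n = 1%gs /\ m = 1%gs.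
Proof.
move: uv; apply: (@group_transfer (fun M rho => BSgen k (rho 0%N) (rho 1%N) ->
  cen (rho 2%N) (rho 1%N) -> cen (rho 3%N) (rho 1%N) ->
  Pow (rho 0%N) (rho 1%N) (rho 2%N) (rho 4%N) -> mg (rho 4%N) (rho 3%N) = eg M ->
  rho 2%N = eg M /\ rho 3%N = eg M) _ _ (env n m w n n)); first by gdef.
have [om [pi [Q _]]] := frame_qmodel hk FB; have hB := frame_group FB.
move=> rho [bs _] hn hm /(PowE hk Q bs _ hn)[p1 o1]; rewrite mgE egE => e.
have [om1 pi1] := om1 Q; have [_ ou _] := BSrel_pi hk Q bs.
have m1 : rho 3%N = 1%gs.
  apply: (cen_v_inj hk Q bs hm (cen1 hB _)); rewrite pi1.
  by have := congr1 pi e; rewrite (q_pi Q) p1 add0r pi1.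
split=> //; apply: (cen_v_inj hk Q bs hn (cen1 hB _)); rewrite pi1.
move: o1; have -> : rho 4%N = 1%gs by rewrite -e m1 gmulr1.
by rewrite om1 => /esym/eqP; rewrite mulf_eq0 (negbTE ou) intr_eq0 => /eqP.
Qed.

Lemma cen_decomposition g : exists w c, [/\ cen (M := M) w u, C c & g = (w * c)%gs].
Proof.
suff [w [c [? [? ?]]]] : exists w c, cen (M := M) w u /\ C c /\ g = (w * c)%gs by exists w, c.
move: uv; apply: (@group_transfer (fun M rho => BSgen k (rho 0%N) (rho 1%N) ->
  exists w c, cen w (rho 0%N) /\ cen c (rho 1%N) /\ rho 2%N = mg w c) _ _ (env g g g g g)); first by gdef.
have [om [pi [Q _]]] := frame_qmodel hk FB; have hB := frame_group FB.
move=> rho [bs _]; have [c hc cE] := cen_v_surj hk Q bs (pi (rho 2%N)).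
exists (rho 2%N * c^-1)%gs, c; split; first by apply/(cen_u hk Q bs); rewrite (q_pi Q) (piV Q) cE subrr.
by split=> //; rewrite mgE gmulrKV.
Qed.

(** The conjugation law for possibly nonstandard [i]. There [k^i] makes sense only in the ring
    carried by the centralizer, so the exponentiation formula [e] is evaluated through [rsat]. *)
Lemma Pow_exp e : (forall (N : structure Lring) (rho : nat -> N), sat rho e <-> ExpK k (rho 0%N) (rho 1%N)) ->
  forall p i n m w, C p -> C i -> C n -> C m -> rsat (M := M) u v (fun j => if j is 0%N then p else i) e ->
  Pow_uv n w -> Mul_uv n p m -> Pow_uv m (cjg (M := M) w i).
Proof.
move=> eP p i n m w; move: uv; apply: (@group_transfer (fun M rho => BSgen k (rho 0%N) (rho 1%N) ->
  cen (rho 2%N) (rho 1%N) -> cen (rho 3%N) (rho 1%N) -> cen (rho 4%N) (rho 1%N) -> cen (rho 5%N) (rho 1%N) ->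
  rsat (rho 0%N) (rho 1%N) (fun j => if j is 0%N then rho 2%N else rho 3%N) e ->
  Pow (rho 0%N) (rho 1%N) (rho 4%N) (rho 6%N) ->
  Mul (rho 0%N) (rho 1%N) (rho 4%N) (rho 2%N) (rho 5%N) ->
  Pow (rho 0%N) (rho 1%N) (rho 5%N) (cjg (rho 6%N) (rho 3%N))) _ _ (env p i n m w)).
  apply: def_imp; first by gdef.
  do 4! (apply: def_imp; first by gdef).
  apply: def_imp; last by gdef.
  apply: (def_iff _ (def_rename (fun j => nth 3 [:: 0; 1; 2] j)%N (def_rsat _ e))) => N rho /=.
  by have -> : (fun n => rho (nth 3 [:: 2] n)%N) = (fun j => if j is 0%N then rho 2%N else rho 3%N) by apply: funext => -[|[|j]].
have [om [pi [Q _]]] := frame_qmodel hk FB; have hB := frame_group FB.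
move=> rho [bs _] hp hi hn hm.
have [h [C hE]] := qmodel_copy hk Q bs.
have [p0 pE] := copy_surj C hp; have [i0 iE] := copy_surj C hi.
have -> : (fun j => if j is 0%N then rho 2%N else rho 3%N) = (fun j => h (if j is 0%N then p0 else i0)).
  by apply: funext => -[|j].
move=> /(rsat_copy C)/eP/ExpK_int[i1 pEE] /(PowE hk Q bs _ hn)[w0 wE] /(MulE hk Q bs hn hp hm) mE.
have [o q] := cjgE Q (rho 3%N) w0; apply/(PowE hk Q bs _ hm); split=> //.
rewrite o wE mE pE iE !hE rmorphM pEE rmorphXn rmorph_nat mulrA exprnP.
by congr (_ * _ ^ _); lia.
Qed.

Lemma BSgen_generates w : cen (M := M) w u -> exists i n, [/\ C i, C n & Pow_uv n (cjg (M := M) w i)].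
Proof. by move=> hw; have [_ /(_ w hw)[i [n [h1 [h2 h3]]]]] := uv; exists i, n. Qed.

(** Through [rsat] a ring sentence becomes a group formula in [u] and [v], so the theory of the
    integers reaches the centralizer before any ring structure on it is constructed. The assignment
    [v] is a placeholder. *)
Lemma rsat_int_sentence (p : formula Lring) : sentence p -> holds (ring_struct int) p ->
  rsat (M := M) u v (fun=> v) p.
Proof.
move=> sp hp; move: uv; apply: (@group_transfer (fun M rho => BSgen k (rho 0%N) (rho 1%N) ->
   rsat (rho 0%N) (rho 1%N) (fun=> rho 1%N) p) _ _ (env u u u u u)).
  apply: def_imp; first by gdef.
  exact: (def_rename (fun j => nth 1 [:: 0] j)%N (def_rsat _ p)).
have [om [pi [Q _]]] := frame_qmodel hk FB.
move=> rho [bs _]; have [h [C _]] := qmodel_copy hk Q bs.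
have -> : (fun _ : nat => rho 1%N) = (fun n => h ((fun=> rone (ring_struct int)) n)).
  by rewrite (copy1 C).
by apply/(rsat_copy C); exact: hp.
Qed.
End ElementaryEquivalents.

(** * Coordinates on a group elementarily equivalent to [BS(1,k)] *)

Section Coordinatization.
Variables (k : nat) (hk : (1 < k)%N).
Variables (B : group_str) (al be : int -> gcar B) (FB : frame k al be).
Variables (G : group_str) (hG : is_group G) (GB : group_elem_equiv G B).
Variables (u v : gcar G) (uv : BSgen (M := group_struct G) k u v).
Local Notation M := (group_struct G).
Local Notation C x := (cen (M := M) x v).

Lemma centralizer_model : exists (N : structure Lring) (h : N -> M),
  elem_equiv N (ring_struct int) /\ ring_copy (M := M) u v h.
Proof.
pose T := {x : gcar G | C x}.
have Tinj (x y : T) : sval x = sval y -> x = y.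
  by case: x y => [x hx] [y hy] /= e; subst y; congr exist; exact: Prop_irrelevance.
have /choice[mulf mulP] : forall xy : T * T, exists z : T, Mul (M := M) u v (sval xy.1) (sval xy.2) (sval z).
  case=> [[x hx] [y hy]] /=; have [z [hz e]] := Mul_total hk FB GB uv hx hy.
  by exists (exist _ z hz).
pose N := @Structure Lring T (fun f => match f return ('I_(rarity f) -> T) -> T with
  | RAdd => fun a => exist _ (sval (a ord0) * sval (a ord_max))%gs (cenM hG (svalP (a ord0)) (svalP (a ord_max)))
  | RMul => fun a => mulf (a ord0, a ord_max)
  | RZero => fun _ => exist _ 1%gs (cen1 hG v)
  | ROne => fun _ => exist _ v erefl end).
have copy : ring_copy (M := M) u v (N := N) sval.
  split=> //.
  - by move=> x; exact: (proj2_sig x).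
  - by move=> y hy; exists (exist _ y hy).
  - move=> x y z; split=> [e|->]; last exact: mulP (x, y).
    apply: Tinj; apply: (Mul_fun hk FB GB uv (svalP x) (svalP y) (svalP z) (svalP (mulf (x, y))) e).
    exact: mulP (x, y).
exists N, sval; split=> //.
have half p : sentence p -> holds (ring_struct int) p -> holds N p.
  move=> sp hp rho; have := rsat_int_sentence hk FB GB uv sp hp.
  have -> : (fun _ : nat => v) = (fun n => sval ((fun=> rone N) n)) by [].
  by move/(rsat_copy copy); apply: (iffLR (sat_ext sp _)).
move=> p sp; split; last exact: half.
(* The theory of the integers is complete, so the converse is [half] applied to the negation of
   [p]. *)
move=> hN; apply: contrapT => hn.
have hnp : holds (ring_struct int) (FImp p (FBot _)).
  by move=> rho hp; apply: hn => rho'; apply: (iffLR (sat_ext sp _)) hp.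
exact: (half (FImp p (FBot _)) (conj sp I) hnp (fun=> rone N) (hN _)).
Qed.

Lemma coordinatization : exists R : idomainType, ring_elem_equiv R int /\
  exists al' be' : R -> gcar G, frame k al' be'.
Proof.
have [N [h [eN C]]] := centralizer_model.
have [R [hR [g [[g' gK g'K] gD gM g0 g1]]]] := model_idomain eN.
exists R; split=> //.
pose be' (x : R) : gcar G := h (g x).
have CR : ring_copy (M := M) u v (N := ring_struct R) be'.
  split.
  - by move=> x; exact: copy_cen C _.
  - by move=> y /(copy_surj C)[x ->]; exists (g' x); rewrite /be' g'K.
  - by move=> x y /(copy_inj C)/(can_inj gK).
  - by move=> x y; rewrite /be' [radd x y]raddE gD (copyD C).
  - by rewrite /be' [g _]g0 (copy0 C).
  - by rewrite /be' [g _]g1 (copy1 C).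
  - move=> x y z; rewrite /be' (copyM C) -gM; split=> [/(can_inj gK)|->] //.
have hc := copy_cen CR.
have /choice[al' alP] : forall n : R, exists w : gcar G, Pow (M := M) u v (be' n) w.
  by move=> n; exact: (Pow_total hk FB GB uv (hc n)).
exists al', be'.
have beD x y : be' (x + y) = (be' x * be' y)%gs by exact: (copyD CR).
have be0 : be' 0 = 1%gs by exact: (copy0 CR).
have beN x : be' (- x) = ((be' x)^-1)%gs by apply: ginv_uniq => //; rewrite -beD subrr.
have alE n w : Pow (M := M) u v (be' n) w -> w = al' n.
  by move=> h'; exact: (Pow_fun hk FB GB uv (hc n) h' (alP n)).
split=> //.
- move=> x y; apply/esym/alE; rewrite beD.
  exact: (PowM hk FB GB uv (hc x) (hc y) (alP x) (alP y)).
- move=> p i n pi; apply: alE; rewrite beN.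
  have [e eP] : def (S := fun N : structure Lring => N) (fun N rho => ExpK k (rho 0%N) (rho 1%N)) by rfo.
  apply: (Pow_exp hk FB GB uv eP (hc p) (hc i) (hc n) (hc (n * p)) _ (alP n)); last exact/(copyM CR).
  have -> : (fun j => if j is 0%N then be' p else be' i) = (fun j => be' (if j is 0%N then p else i)).
    by apply: funext => -[].
  by apply/(rsat_copy CR)/eP.
- move=> x; have [w [c [hw hcc ->]]] := cen_decomposition hk FB GB uv x.
  have [i [n [hi hn hP]]] := BSgen_generates uv hw.
  have [i0 iE] := copy_surj CR hi; have [n0 nE] := copy_surj CR hn; have [m0 mE] := copy_surj CR hcc.
  exists n0, i0, m0; move: hP; rewrite nE => /alE <-.
  by rewrite mE beN iE /cjg !mgE igE !gmulA // gmulrV // gmul1 // gmulrK.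
- move=> n m e; have := Pow_free hk FB GB uv (hc n) (hc m) (alP n) e.
  by rewrite -be0 => -[/(copy_inj CR) -> /(copy_inj CR) ->].
Qed.
End Coordinatization.

Theorem theorem5p3 (k : nat) (hk : (1 < k)%N) :
  (forall (B : group_str) (a b : gcar B), @is_BS_presentation k B a b ->
     (forall R : idomainType, ring_elem_equiv R int ->
        group_elem_equiv B (BSk k R))
     /\ (forall G : group_str, is_group G -> group_elem_equiv G B ->
        exists R : idomainType, ring_elem_equiv R int /\ group_iso G (BSk k R)))
  /\ (forall R1 R2 : idomainType,
        ring_elem_equiv R1 int -> ring_elem_equiv R2 int ->
        (group_iso (BSk k R1) (BSk k R2) <-> ring_iso R1 R2)).
Proof.
split=> [B a b HB|R1 R2 h1 h2].
  have FB := presentation_frame hk HB; split=> [R hR|G hG GB].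
    exact: (frame_elem_equiv (Framed int_equiv FB) (Framed hR (BSk_frame hk hR))).
  have [u [v uv]] := ex_BSgen hk FB GB.
  have [R [hR [al [be F]]]] := coordinatization hk FB hG GB uv.
  by exists R; split=> //; exact: (frame_uniq hR F (BSk_frame hk hR)).
have [F1 F2] := (BSk_frame hk h1, BSk_frame hk h2).
split=> [[f [bf fM fV f1]]|[phi [bphi phiD phiM phi1]]].
  have [G1 G2] := (frame_group F1, frame_group F2).
  have uv := frame_BSrel h1 F1.
  (* The images of the generators again satisfy [BSrel], so they define a copy of [R2] that can be
     compared with the copy of [R1]. *)
  have uv' := BSrel_iso G1 G2 bf fM uv.
  have [g1 C1] := framed_copy hk (F := Framed h1 F1) uv.
  have [g2 C2] := framed_copy hk (F := Framed h2 F2) uv'.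
  exact: (copies_ring_iso G1 G2 bf fM C1 C2).
have [psi phiK psiK] := bphi.
exact: (frame_uniq h2 (frame_transport bphi phiD phiM phi1 psiK F1) F2).
Qed.
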